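(* Consider the linear model $y=X\beta+\epsilon$ with $\beta\in\mathbb{R}^p$ having support $S$, $|S|=s$. Assume the sub-Gaussian error condition and the sub-Gaussian design condition stated in the context, and $s\log p\ll n$. Let $j\in\{1,\dots,p\}$ and let $\hat\beta_j^{(BS-DB)}$ be the bootstrapped debiased Lasso estimator (with $\Theta=\Sigma^{-1}$ unknown) computed with $\lambda=c_1\sqrt{\log p/n}$ and $\lambda_j=c_2\sqrt{\log p/n}$ for some sufficiently large constants $c_1$ and $c_2$. Then $$\hat\beta_j^{(BS-DB)}-\beta_j=\frac{\langle\hat w_j,\epsilon\rangle}{n}+O_P\!\left(\frac{s\log p}{n}\right).$$
   Context: Model: $y_i=x_i^T\beta+\epsilon_i$, $i=1,\dots,n$, where $X\in\mathbb{R}^{n\times p}$ has $i$-th row $x_i^T$ and $j$-th column $X_j$, $y=(y_1,\dots,y_n)^T$, $\epsilon=(\epsilon_1,\dots,\epsilon_n)^T$ is independent of $X$, and $S=\{j:\beta_j\ne0\}$, $|S|=s$. For a random variable, $\|v\|_{\psi_2}=\sup_{t\ge1}t^{-1/2}(\mathbb{E}|v|^t)^{1/t}$; for a random vector, $\|V\|_{\psi_2}=\sup_{\|b\|_2=1}\|\langle V,b\rangle\|_{\psi_2}$. Sub-Gaussian error condition: $\epsilon_1,\dots,\epsilon_n$ are i.i.d. with mean $0$, variance $\sigma^2>0$ and $\max_i\|\epsilon_i\|_{\psi_2}\le K_2$. Sub-Gaussian design condition: the rows of $X$ are i.i.d. from a sub-Gaussian distribution with mean zero and covariance matrix $\Sigma$,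 where $0<C_{\min}\le\Lambda_{\min}(\Sigma)\le\Lambda_{\max}(\Sigma)\le C_{\max}<\infty$ (smallest/largest eigenvalues), and $\max_{1\le i\le n}\|\Sigma^{-1/2}x_i\|_{\psi_2}\le K_1<\infty$. BS-DB estimator with unknown $\Theta$. Lasso: $\hat\beta=\arg\min_{b\in\mathbb{R}^p}\{\frac{1}{2n}\|y-Xb\|_2^2+\lambda\|b\|_1\}$, $\widehat S=\{k:\hat\beta_k\ne0\}$. Correction score: $\hat w_j=nX\hat\kappa/\langle X_j,X\hat\kappa\rangle$, where $\hat\kappa=\arg\min_{\kappa\in\mathbb{R}^p}\{\frac1{2n}\|X\kappa\|_2^2+\lambda_j\|\kappa_{\widehat S^c\setminus\{j\}}\|_1:\kappa_j=1\}$. Modified debiased Lasso: $\hat\beta_j^{(mDB)}=\hat\beta_j+\langle\hat w_j,y-X\hat\beta\rangle/n$. Noiseless bootstrapped Lasso: $\hat\beta^*=\arg\min_{b\in\mathbb{R}^p}\{\frac{1}{2n}\|X\hat\beta-Xb\|_2^2+\lambda\|b\|_1\}$. Estimated bias: $\hat b_j^*=\hat\beta_j^*+\langle\hat w_j,X(\hat\beta-\hat\beta^* )\rangle/n-\hat\beta_j$. Finally $\hat\beta_j^{(BS-DB)}=\hat\beta_j^{(mDB)}-\hat b_j^*$. Asymptotics: $n\to\infty$, $p\to\infty$, with $p,s,\beta,\Sigma,j$ allowed to vary with $n$; $C_{\min},C_{\max},K_1,K_2,\sigma,c_1,c_2$ are constants. $f\ll g$ means $f=o(g)$. $Z_n=O_P(a_n)$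 means that for every $\delta>0$ there is $M$ with $\limsup_n\mathbb{P}(|Z_n|>Ma_n)\le\delta$. *)

(* Defs.v *)
From HB Require Import structures.
From mathcomp Require Import all_boot all_order all_algebra.
From mathcomp Require Import all_classical all_reals all_analysis.

Set Implicit Arguments.
Unset Strict Implicit.
Unset Printing Implicit Defensive.

Import Order.TTheory GRing.Theory Num.Theory.
Import numFieldNormedType.Exports.

Local Open Scope classical_set_scope.
Local Open Scope ring_scope.

(* The library's measurable structure on n.-tuple is the product sigma-algebra,
   so random vectors and random designs are tuple-valued random variables;
   these two functions give their values as a column vector and as a matrix
   whose i-th row is the i-th observation. *)
Definition col_of_tuple (R : realType) (n : nat) (t : n.-tuple R) : 'cV[R]_n :=
  \col_i tnth t i.

Definition mx_of_rows (R : realType) (n p : nat) (t : n.-tuple (p.-tuple R)) :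
    'M[R]_(n, p) :=
  \matrix_(i, k) tnth (tnth t i) k.

Section vectors.
Context {R : realType}.

(* `|v| on matrices is the sup norm, hence the explicit l1 and l2 norms. *)
Definition dotv m (u v : 'cV[R]_m) : R := \sum_i u i 0 * v i 0.
Definition l1norm m (v : 'cV[R]_m) : R := \sum_i `|v i 0|.
Definition l2norm m (v : 'cV[R]_m) : R := Num.sqrt (\sum_i v i 0 ^+ 2).

Definition supp m (v : 'cV[R]_m) : {set 'I_m} := [set k | v k 0 != 0]%SET.

Definition Lambda_min m (A : 'M[R]_m) : R := inf [set a | eigenvalue A a].
Definition Lambda_max m (A : 'M[R]_m) : R := sup [set a | eigenvalue A a].

Definition posdef m (A : 'M[R]_m) : Prop :=
  A^T = A /\ forall v : 'cV[R]_m, v != 0 -> 0 < dotv v (A *m v).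

(* B = A^{-1/2}: the (unique) positive definite square root of A^-1. *)
Definition is_inv_sqrtmx m (A B : 'M[R]_m) : Prop :=
  [/\ A \in unitmx, posdef B & B *m B = invmx A].

End vectors.

Definition is_argmin (R : realType) (T : Type) (D : set T) (f : T -> R) (x : T) :
    Prop :=
  D x /\ forall y, D y -> f x <= f y.

Section probability_notions.
Context d (T : measurableType d) {R : realType} (P : probability T R).

Definition psi2 (v : T -> R) : \bar R :=
  ereal_sup [set ((t `^ (- 2^-1))%:E * 'N[P]_(t%:E) [EFin \o v])%E
            | t in [set t : R | 1 <= t]].

Definition psi2_vec m (V : T -> 'cV[R]_m) : \bar R :=
  ereal_sup [set psi2 (fun w => dotv (V w) b)
            | b in [set b : 'cV[R]_m | l2norm b = 1]].

Definition indep2 d1 d2 (T1 : measurableType d1) (T2 : measurableType d2)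
    (U : T -> T1) (V : T -> T2) : Prop :=
  forall A B, measurable A -> measurable B ->
    P (U @^-1` A `&` V @^-1` B) = (P (U @^-1` A) * P (V @^-1` B))%E.

(* Taking some of the A i to be setT gives the product rule for subfamilies. *)
Definition mutually_indep n d1 (T1 : measurableType d1) (U : 'I_n -> T -> T1) :
    Prop :=
  forall A : 'I_n -> set T1, (forall i, measurable (A i)) ->
    P (\bigcap_i (U i @^-1` A i)) = (\prod_i P (U i @^-1` A i))%E.

Definition same_law d1 (T1 : measurableType d1) (U V : T -> T1) : Prop :=
  forall A, measurable A -> P (U @^-1` A) = P (V @^-1` A).

Definition iid n d1 (T1 : measurableType d1) (U : 'I_n -> T -> T1) : Prop :=
  mutually_indep U /\ forall i i', same_law (U i) (U i').

Definition subgaussian_errors n (eps : {RV P >-> n.-tuple R}) (sigma K2 : R) :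
    Prop :=
  let e (i : 'I_n) (w : T) := tnth (eps w) i in
  [/\ iid e,
      forall i, ('E_P[e i] = 0)%E,
      forall i, ('V_P[e i] = (sigma ^+ 2)%:E)%E &
      forall i, (psi2 (e i) <= K2%:E)%E].

Definition subgaussian_design n p (X : {RV P >-> n.-tuple (p.-tuple R)})
    (Sigma : 'M[R]_p) (Cmin Cmax K1 : R) : Prop :=
  let row (i : 'I_n) (w : T) := tnth (X w) i in
  let entry i (k : 'I_p) (w : T) := tnth (row i w) k in
  [/\ iid row,
      forall i k, ('E_P[entry i k] = 0)%E,
      forall i k l, covariance P (entry i k) (entry i l) = (Sigma k l)%:E,
      [/\ Cmin <= Lambda_min Sigma, Lambda_min Sigma <= Lambda_max Sigma &
          Lambda_max Sigma <= Cmax] &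
      exists2 B : 'M[R]_p, is_inv_sqrtmx Sigma B &
        forall i, (psi2_vec (fun w => B *m col_of_tuple (row i w)) <= K1%:E)%E].

End probability_notions.

Definition O_in_prob (R : realType) (d : nat -> measure_display)
    (T : forall n, measurableType (d n)) (P : forall n, probability (T n) R)
    (Z : forall n, T n -> R) (a : nat -> R) : Prop :=
  forall delta : R, 0 < delta -> exists M : R,
    (limn_esup (fun n => P n [set w | M * a n < `|Z n w|]%R) <= delta%:E)%E.

Section estimators.
Context {R : realType} (n p : nat).
Implicit Types (X : 'M[R]_(n, p)) (y : 'cV[R]_n) (b kappa : 'cV[R]_p).

Definition lasso_obj X y (lambda : R) b : R :=
  (2 * n%:R)^-1 * l2norm (y - X *m b) ^+ 2 + lambda * l1norm b.

Definition is_lasso X y (lambda : R) b : Prop :=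
  is_argmin setT (lasso_obj X y lambda) b.

Definition kappa_obj X (Shat : {set 'I_p}) (j : 'I_p) (lambdaj : R) kappa : R :=
  (2 * n%:R)^-1 * l2norm (X *m kappa) ^+ 2 +
  lambdaj * \sum_(k | (k \notin Shat) && (k != j)) `|kappa k 0|.

Definition is_kappa X (Shat : {set 'I_p}) (j : 'I_p) (lambdaj : R) kappa : Prop :=
  is_argmin [set k : 'cV[R]_p | k j 0 = 1] (kappa_obj X Shat j lambdaj) kappa.

Definition score X (j : 'I_p) kappa : 'cV[R]_n :=
  (n%:R / dotv (col j X) (X *m kappa)) *: (X *m kappa).

Definition mDB X y (j : 'I_p) (bhat : 'cV[R]_p) (w : 'cV[R]_n) : R :=
  bhat j 0 + dotv w (y - X *m bhat) / n%:R.

Definition boot_bias X (j : 'I_p) (bhat bstar : 'cV[R]_p) (w : 'cV[R]_n) : R :=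
  bstar j 0 + dotv w (X *m (bhat - bstar)) / n%:R - bhat j 0.

Definition BSDB X y (j : 'I_p) (bhat bstar : 'cV[R]_p) (w : 'cV[R]_n) : R :=
  mDB X y j bhat w - boot_bias X j bhat bstar w.

End estimators.

(* Main.v *)
Require Import Defs.
From HB Require Import structures.
From mathcomp Require Import all_boot all_order all_algebra.
From mathcomp Require Import all_classical all_reals all_analysis.
From mathcomp Require Import measurable_realfun ring lra.

Set Implicit Arguments.
Unset Strict Implicit.
Unset Printing Implicit Defensive.

Import Order.TTheory GRing.Theory Num.Theory.
Import numFieldNormedType.Exports.

Local Open Scope classical_set_scope.
Local Open Scope ring_scope.

(* With D := <X_j, X kappa> / n and x := 2 (bhat - beta) - (bstar - beta), the
   remainder is exactly x_j - <w, X x> / n = - sum_(k <> j) x_k <X_k, X kappa> / (n D).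
   The optimality conditions of kappa bound each <X_k, X kappa> / n by lambda_j,
   so the remainder is at most (lambda_j / D) |x|_1, and it remains to show that
   |x|_1 = O(s lambda) and that D stays away from 0, with high probability.

   Both follow from |X^T eps / n|_oo <= lambda / 2 and from the two-sided bound
   |v|_2^2 - r |v|_1^2 <~ |X v|_2^2 / n <~ |v|_2^2 + r |v|_1^2, r ~ log p / n,
   for all v.  For bhat this is the usual Lasso argument; bstar is compared with
   beta, not with bhat, so that no sparsity of bhat is needed; a bound
   #|supp bhat| = O(s) is needed only for D.  Each tail event of the noise is
   treated conditionally on eps, which works for any p; hence when s = 0, where
   log p << n is not available, both Lasso solutions are 0 with high probability
   and the remainder vanishes.

   The two-sided bound is proved for sums of m ~ n / log p signed basis vectors
   by Chernoff and a union bound over the (2 p)^m such sums, and extended to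
   all v by Maurey's empirical method: if |v|_1 = 1 and Z_1, ..., Z_m are
   independent with Z_i = sgn(v_k) e_k with probability |v_k|, then, for any
   quadratic form Q, E Q(Z_1 + ... + Z_m) = m (m - 1) Q(v) + m sum_k |v_k| Q(e_k). *)

(** * Exponential inequalities and sub-Gaussian moments *)

(** The lower bound is useful at [v] only if [r |v|_1^2] is dominated by [a |v|_2^2]. For the two
    Lasso errors this comes from an (approximate) cone condition around the support of [beta]. The
    direction [kappa] has no such structure: on [supp bhat] it is unpenalised, so there its l1 norm
    is controlled only through the number of coordinates, and elsewhere only by the penalty, which
    comparison with the basis vector [e_j] bounds by a constant over [lambda_j]. Hence the need for
    a support bound in the estimate of D, and hence the requirement on [c2]: [lambda_j^2] must
    dominate a multiple of [r].

    The number m of summands balances two costs. The union over the sums must be affordable against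
    tails of order exp(-c n), which limits m to a multiple of n / log p; Maurey's step loses a
    multiple of [|v|_1^2 / (m - 1)], which is [r |v|_1^2]. It is applied to differences of the Gram
    form and multiples of the covariance form, which may be indefinite: nonnegativity on the sums is
    all that it uses. *)

Section exponential_bounds.
Context {R : realType}.
Implicit Types x : R.

(** For a centred variable the linear term integrates to 0, so exponential moments of the square
    bound the moment generating function. Up to 1/2 the inequality goes through
    [expR x <= 1 / (1 - x) <= 1 + x + 2 x^2]; beyond 1/2, [x <= 2 x^2]. *)
Lemma expR_le_addr_expR_sqr x : expR x <= x + expR (2 * x ^+ 2).
Proof.
have e2 : 1 + 2 * x ^+ 2 <= expR (2 * x ^+ 2) by exact: expR_ge1Dx.
have [xh|xh] := lerP x 2^-1.
  apply: le_trans (_ : 1 + x + 2 * x ^+ 2 <= _); last by lra.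
  have h := expR_ge1Dx (- x).
  have p0 : 0 < 1 - x by lra.
  have := expR_gt0 x.
  have := expRxMexpNx_1 x.
  nra.
apply: le_trans (_ : expR (2 * x ^+ 2) <= _); last by lra.
by rewrite ler_expR; nra.
Qed.

(** From [expR (- x) <= 1 / (1 + x)]. The second-order term lets a fourth moment, in place of
    boundedness, control the lower tail of a sum of squares. *)
Lemma expRN_le x : 0 <= x -> expR (- x) <= 1 - x + x ^+ 2.
Proof.
move=> x0; have := expR_ge1Dx x; have := expR_gt0 (- x).
have := expRxMexpNx_1 x; nra.
Qed.

Lemma expR1_le4 : expR 1 <= 4 :> R.
Proof.
have -> : (1 : R) = 2^-1 + 2^-1 by field.
rewrite expRD; have := expR_ge1Dx (- 2^-1 : R).
have := expR_gt0 (2^-1 : R); have := expRxMexpNx_1 (2^-1 : R); nra.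
Qed.

(** [k^k / k!] is one term of the series of [expR k], and e is at most 4. This trades the [k^k] of
    sub-Gaussian moments for the [k!] of the exponential series. *)
Lemma exprnn_le_fact (k : nat) : (k%:R ^+ k : R) <= 4 ^+ k * (k`!)%:R.
Proof.
case: k => [|k]; first by rewrite !expr0 mul1r.
have f0 : 0 < (k.+1`!)%:R :> R by rewrite ltr0n fact_gt0.
have /= := @expR_ge1Dxn R k.+1%:R k (ler0n _ _).
rewrite -[X in expR X]mulr1 expRM_natl => h.
rewrite -ler_pdivrMr//.
apply: le_trans (_ : expR 1 ^+ k.+1 <= _); first by apply: le_trans h; rewrite lerDr.
by apply: lerXn2r; rewrite ?nnegrE ?expR_ge0 ?expR1_le4.
Qed.

Lemma inv1B_le_expR x : 0 <= x <= 2^-1 -> (1 - x)^-1 <= expR (2 * x).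
Proof.
move=> /andP[x0 x1]; apply: le_trans (expR_ge1Dx (2 * x)).
by rewrite -[leLHS]mul1r ler_pdivrMr; nra.
Qed.

End exponential_bounds.

Section subgaussian_moments.
Local Open Scope ereal_scope.
Context d (T : measurableType d) (R : realType) (P : probability T R).
Implicit Types (v : T -> R) (tau t : R).

(** The psi_2 bound at even exponents, with [tau] in the place of the squared norm. Even powers need
    no absolute value and are all that the series of [expR (t * v ^+ 2)] involves. *)
Definition subgaussian_moments v tau :=
  forall k : nat, \int[P]_w (v w ^+ k.*2)%:E <= ((k.*2%:R * tau) ^+ k)%:E.

Lemma Lnorm_even_le v (k : nat) (C : R) : (0 < k)%N -> (0 <= C)%R ->
  'N[P]_(k%:R%:E)[EFin \o v] <= C%:E ->
  \int[P]_w (`|v w| ^+ k)%:E <= (C ^+ k)%:E.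
Proof.
move=> k0 C0 h.
have kr : (k%:R != 0 :> R)%R by rewrite pnatr_eq0 -lt0n.
have -> : \int[P]_w (`|v w| ^+ k)%:E = 'N[P]_(k%:R%:E)[EFin \o v] `^ k%:R.
  rewrite poweR_Lnorm//; apply: eq_integral => w _ /=.
  by rewrite [RHS](poweR_EFin `|v w| k%:R) powR_mulrn.
rewrite -powR_mulrn// -poweR_EFin.
apply: (gt0_ler_poweR (ler0n _ k) _ _ h).
- by rewrite in_itv/= leey Lnorm_ge0.
- by rewrite in_itv/= leey lee_fin C0.
Qed.

Lemma psi2_subgaussian_moments v (K : R) : (0 <= K)%R ->
  psi2 P v <= K%:E -> subgaussian_moments v (K ^+ 2).
Proof.
move=> K0 h k; case: k => [|k].
  under eq_integral do rewrite expr0.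
  by rewrite expr0 integral_cst//= probability_setT mul1e.
pose m := k.+1.*2.
have m0 : (0 < m)%N by [].
rewrite -/m.
have m0R : (0 < m%:R :> R)%R by rewrite ltr0n.
have -> : ((m%:R * K ^+ 2) ^+ k.+1 = ((Num.sqrt m%:R * K) ^+ 2) ^+ k.+1)%R.
  by congr (_ ^+ _)%R; rewrite exprMn sqr_sqrtr// ltW.
rewrite -exprM mul2n -/m.
have -> : \int[P]_w (v w ^+ m)%:E = \int[P]_w (`|v w| ^+ m)%:E.
  apply: eq_integral => w _; congr (_%:E).
  by rewrite /m -mul2n !exprM real_normK// num_real.
apply: Lnorm_even_le => //; first by rewrite mulr_ge0// sqrtr_ge0.
have : ((m%:R `^ (- 2^-1))%:E * 'N[P]_(m%:R%:E)[EFin \o v]) <= K%:E.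
  apply: le_trans h; apply: ereal_sup_ubound; exists m%:R => //=.
  by rewrite ler1n.
by rewrite powRN (powR12_sqrt (ltW m0R)) lee_pdivrMl ?sqrtr_gt0.
Qed.

Lemma subgaussian_momentsZ v tau (c : R) :
  measurable_fun setT v -> subgaussian_moments v tau ->
  subgaussian_moments (fun w => c * v w)%R (c ^+ 2 * tau).
Proof.
move=> mv h k.
have c0 : (0 <= c ^+ k.*2)%R by rewrite -mul2n exprM exprn_ge0// sqr_ge0.
under eq_integral do rewrite exprMn EFinM.
rewrite ge0_integralZl_EFin//.
- rewrite mulrCA exprMn EFinM -exprM mul2n.
  by apply: lee_wpmul2l; rewrite ?lee_fin.
- by move=> w _; rewrite lee_fin -mul2n exprM exprn_ge0// sqr_ge0.
- by apply/measurable_EFinP; exact: measurable_funX.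
Qed.

Lemma subgaussian_moments_tau_ge0 v tau : subgaussian_moments v tau -> (0 <= tau)%R.
Proof.
move=> /(_ 1%N) h; have : 0 <= ((1.*2%:R * tau) ^+ 1)%:E.
  by apply: le_trans h; apply: integral_ge0 => w _; rewrite lee_fin exprn_even_ge0.
by rewrite expr1 lee_fin pmulr_rge0.
Qed.

(** Integrating the exponential series term by term, the k-th term is at most [(8 tau t)^k], because
    [(2 k tau)^k / k! <= (8 tau)^k]. The hypothesis on [t] keeps this ratio at most 1/2, where the
    geometric sum is at most [expR (16 tau t)]. *)
Lemma integral_expR_sqr_le v tau t : measurable_fun setT v ->
  subgaussian_moments v tau -> (0 <= t)%R -> (16 * tau * t <= 1)%R ->
  \int[P]_w (expR (t * v w ^+ 2))%:E <= (expR (16 * tau * t))%:E.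
Proof.
move=> mv h t0 t1.
have tau0 := subgaussian_moments_tau_ge0 h.
pose x := (8 * tau * t)%R.
have x0 : (0 <= x <= 2^-1)%R.
  by rewrite /x; apply/andP; split; [rewrite !mulr_ge0|lra].
have e0 k w : (0 <= exp_coeff (t * v w ^+ 2) k)%R.
  by rewrite exp_coeff_ge0// mulr_ge0// sqr_ge0.
have -> : \int[P]_w (expR (t * v w ^+ 2))%:E =
    \int[P]_w (\sum_(0 <= k <oo) (exp_coeff (t * v w ^+ 2) k)%:E).
  apply: eq_integral => w _; rewrite /expR -EFin_lim;
    last exact: is_cvg_series_exp_coeff.
  by congr (limn _); apply/funext => k /=; rewrite /series/= -sumEFin.
rewrite integral_nneseries//; last 2 first.
- move=> n; apply/measurable_EFinP; rewrite /exp_coeff/=.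
  apply: measurable_funM => //; apply: measurable_funX.
  by apply: measurable_funM => //; exact: measurable_funX.
- by move=> n w _; rewrite lee_fin.
apply: lime_le.
  by apply: is_cvg_nneseries => n _ _; apply: integral_ge0 => w _; rewrite lee_fin.
apply: nearW => N; rewrite [leLHS](_ : _ = \sum_(0 <=
  k < N) \int[P]_w (exp_coeff (t * v w ^+ 2) k)%:E)//.
apply: (@le_trans _ _ (\sum_(0 <= k < N) (x ^+ k)%:E)).
  apply: lee_sum => k _.
  under eq_integral => w _.
    rewrite /exp_coeff/= exprMn -exprM mul2n mulrAC EFinM; over.
  rewrite ge0_integralZl_EFin//; last 3 first.
  - by move=> w _; rewrite lee_fin -mul2n exprM exprn_ge0// sqr_ge0.
  - by apply/measurable_EFinP; exact: measurable_funX.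
  - by rewrite divr_ge0// exprn_ge0.
  apply: (@le_trans _ _ ((t ^+ k / k`!%:R)%:E * ((k.*2%:R * tau) ^+ k)%:E)).
    by apply: lee_wpmul2l => //; rewrite lee_fin divr_ge0// exprn_ge0.
  rewrite -EFinM lee_fin.
  have -> : ((k.*2%:R * tau) ^+ k = k%:R ^+ k * (2 * tau) ^+ k)%R.
    by rewrite -exprMn -mul2n natrM; congr (_ ^+ _)%R; ring.
  have -> : (x ^+ k = t ^+ k * (4 ^+ k) * (2 * tau) ^+ k)%R.
    by rewrite -!exprMn; congr (_ ^+ _)%R; rewrite /x; ring.
  rewrite mulrA ler_wpM2r ?exprn_ge0 ?mulr_ge0//.
  rewrite mulrAC -mulrA ler_wpM2l ?exprn_ge0//.
  by rewrite ler_pdivrMr ?ltr0n ?fact_gt0// exprnn_le_fact.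
rewrite sumEFin lee_fin; have -> : (16 * tau * t = 2 * x)%R by rewrite /x; ring.
apply: le_trans (inv1B_le_expR x0).
have x1 : (0 < 1 - x)%R by move: x0 => /andP[]; lra.
rewrite -[leRHS]mul1r ler_pdivlMr// big_mkord mulrC -opprB mulNr -subrX1 opprB.
by rewrite gerBl exprn_ge0//; case/andP: x0.
Qed.

Lemma ge0_integrable (f : T -> R) (c : R) : measurable_fun setT f ->
  (forall w, 0 <= f w)%R -> \int[P]_w (f w)%:E <= c%:E ->
  P.-integrable setT (EFin \o f).
Proof.
move=> mf f0 fc; apply/integrableP; split; first exact/measurable_EFinP.
under eq_integral => w _ do rewrite /= ger0_norm//.
by apply: le_lt_trans fc _; exact: ltry.
Qed.

Lemma subgaussian_moments_integrable v tau : measurable_fun setT v ->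
  subgaussian_moments v tau -> P.-integrable setT (EFin \o v).
Proof.
move=> mv h.
have i2 : P.-integrable setT (EFin \o (fun w => v w ^+ 2)%R).
  by apply: ge0_integrable (h 1%N); [exact: measurable_funX|move=> w; exact: sqr_ge0].
have i1 : P.-integrable setT (EFin \o (fun w => 1 + v w ^+ 2)%R).
  have -> : EFin \o (fun w => 1 + v w ^+ 2)%R =
      (EFin \o cst 1%R) \+ (EFin \o (fun w => v w ^+ 2)%R).
    by apply/funext => w /=; rewrite EFinD.
  apply: integrableD => //.
  exact: (@finite_measure_integrable_cst _ _ _ P).
apply: le_integrable i1 => //; first exact/measurable_EFinP.
move=> w _ /=; rewrite lee_fin [leRHS]ger0_norm ?addr_ge0 ?sqr_ge0//.
rewrite -(real_normK (num_real (v w))); have := sqr_ge0 (`|v w| - 1)%R; nra.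
Qed.

Lemma integral_expR_le v tau (a : R) : measurable_fun setT v ->
  subgaussian_moments v tau -> \int[P]_w (v w)%:E = 0 ->
  \int[P]_w (expR (a * v w))%:E <= (expR (36 * tau * a ^+ 2))%:E.
Proof.
move=> mv h v0.
have tau0 := subgaussian_moments_tau_ge0 h.
have ta0 : (0 <= tau * a ^+ 2)%R by rewrite mulr_ge0// sqr_ge0.
have me b : measurable_fun setT (fun w => expR (b * v w ^+ 2)).
  apply: measurableT_comp; first exact: measurable_expR.
  by apply: measurable_funM => //; exact: measurable_funX.
have mea : measurable_fun setT (fun w => expR (a * v w)).
  apply: measurableT_comp; first exact: measurable_expR.
  exact: measurable_funM.
(* For small [a] centring removes the linear term. For large [a], Young's inequality
   [a v <= 4 tau a^2 + v^2 / (16 tau)] is enough: the remaining factor e is at most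
   [expR (32 tau a^2)], whence 36 = 4 + 32. *)
have [small|large] := lerP (32 * tau * a ^+ 2) 1.
  have a20 : (0 <= 2 * a ^+ 2)%R by rewrite mulr_ge0// sqr_ge0.
  have small' : (16 * tau * (2 * a ^+ 2) <= 1)%R by lra.
  have bd := integral_expR_sqr_le mv h a20 small'.
  apply: (@le_trans _ _ (\int[P]_w ((a * v w)%:E + (expR (2 * a ^+ 2 * v w ^+ 2))%:E))).
    apply: ge0_le_integral => //.
    - exact/measurable_EFinP.
    - by apply: emeasurable_funD; apply/measurable_EFinP => //; exact: measurable_funM.
    move=> w _; rewrite -EFinD lee_fin; apply: le_trans (expR_le_addr_expR_sqr _) _.
    by rewrite exprMn mulrA.
  have iv := subgaussian_moments_integrable mv h.
  rewrite integralD//; last 2 first.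
  - by under eq_fun do rewrite EFinM; exact: integrableZl.
  - by apply: ge0_integrable bd => // w; exact: expR_ge0.
  under eq_integral do rewrite EFinM.
  rewrite integralZl// v0 mule0 add0e (le_trans bd)// lee_fin ler_expR; lra.
have taup : (0 < tau)%R.
  by rewrite lt_neqAle tau0 andbT; apply: contraTneq large => <-;
    rewrite mulr0 mul0r ltr10.
pose t := ((16 * tau)^-1)%R.
have t0 : (0 <= t)%R by rewrite invr_ge0 mulr_ge0.
have tE : (16 * tau * t = 1)%R by rewrite mulfV// mulf_neq0// gt_eqF.
have bd : \int[P]_w (expR (t * v w ^+ 2))%:E <= (expR 1)%:E.
  by rewrite -tE; apply: integral_expR_sqr_le; rewrite ?tE.
apply: (@le_trans _ _ (\int[P]_w ((expR (4 * tau * a ^+ 2))%:E * (expR (t * v w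
  ^+ 2))%:E))).
  apply: ge0_le_integral => //.
  - exact/measurable_EFinP.
  - by apply: emeasurable_funM => //; exact/measurable_EFinP.
  move=> w _; rewrite -EFinM -expRD lee_fin ler_expR.
  rewrite -subr_ge0 -(pmulr_rge0 _ (_ : 0 < 16 * tau)%R) ?mulr_gt0//.
  have -> : (16 * tau * (4 * tau * a ^+ 2 + t * v w ^+ 2 - a * v w) =
    64 * tau ^+ 2 * a ^+ 2 + (16 * tau * t) * v w ^+ 2 - 16 * tau * a * v w)%R by ring.
  rewrite tE; have := sqr_ge0 (v w - 8 * tau * a)%R; nra.
rewrite ge0_integralZl_EFin ?expR_ge0//; last exact/measurable_EFinP.
apply: (@le_trans _ _ ((expR (4 * tau * a ^+ 2))%:E * (expR 1)%:E)).
  by apply: lee_wpmul2l => //; rewrite lee_fin expR_ge0.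
rewrite -EFinM -expRD lee_fin ler_expR; lra.
Qed.

Lemma integral_expRN_sqr_le v tau (q t : R) : measurable_fun setT v ->
  subgaussian_moments v tau -> \int[P]_w (v w ^+ 2)%:E = q%:E -> (0 <= t)%R ->
  \int[P]_w (expR (- (t * v w ^+ 2)))%:E <= (1 - t * q + 16 * t ^+ 2 * tau ^+ 2)%:E.
Proof.
move=> mv h vq t0.
have mX k : measurable_fun setT (fun w => v w ^+ k)%R by exact: measurable_funX.
have i2 : P.-integrable setT (EFin \o (fun w => v w ^+ 2)%R).
  by apply: ge0_integrable (h 1%N) => // w; exact: sqr_ge0.
have i4 : P.-integrable setT (EFin \o (fun w => v w ^+ 4)%R).
  by apply: ge0_integrable (h 2%N) => // w; exact: exprn_even_ge0.
have i1 : P.-integrable setT (EFin \o cst 1%R).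
  exact: (@finite_measure_integrable_cst _ _ _ P).
apply: (@le_trans _ _ (\int[P]_w ((1%:E + (- t)%:E * (v w ^+ 2)%:E) +
    (t ^+ 2)%:E * (v w ^+ 4)%:E))).
  apply: ge0_le_integral => //.
  - apply/measurable_EFinP; apply: measurableT_comp; first exact: measurable_expR.
    by apply: measurableT_comp => //; exact: measurable_funM.
  - apply: emeasurable_funD; first apply: emeasurable_funD => //.
      by apply: emeasurable_funM => //; exact/measurable_EFinP.
    by apply: emeasurable_funM => //; exact/measurable_EFinP.
  move=> w _; rewrite -!EFinM -!EFinD lee_fin.
  apply: le_trans (expRN_le _) _; first by rewrite mulr_ge0// sqr_ge0.
  by rewrite exprMn -exprM mulNr.
have i2t : P.-integrable setT (fun w =>
  (- t)%:E * (v w ^+ 2)%:E) by exact: integrableZl.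
rewrite integralD//; last 2 first.
- exact: integrableD.
- exact: integrableZl.
rewrite integralD// !integralZl// vq integral_cst//= probability_setT mule1.
rewrite EFinD; apply: leeD; first by rewrite -EFinM -EFinD mulNr.
have -> : (16 * t ^+ 2 * tau ^+ 2 = t ^+ 2 * (2.*2%:R * tau) ^+ 2)%R.
  by rewrite exprMn -[2.*2%N]/4%N; ring.
rewrite [leRHS]EFinM; apply: lee_wpmul2l; first by rewrite lee_fin sqr_ge0.
exact: (h 2%N).
Qed.

End subgaussian_moments.

(** * Independence and concentration *)

Section independence.
Local Open Scope ereal_scope.
Context d (T : measurableType d) (R : realType) (P : probability T R).

Import HBNNSimple.

(** [H] stands for the product of the other factors and [c] for its mean; independence from [Y]
    enters only through indicators. Simple functions and monotone convergence extend it to [g]. *)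
Lemma ge0_integralM_indep d1 (T1 : measurableType d1) (Y : T -> T1) (H : T -> R)
    (c : R) (g : T1 -> R) :
  measurable_fun setT Y -> measurable_fun setT H -> (forall w, 0 <= H w)%R ->
  measurable_fun setT g -> (forall x, 0 <= g x)%R ->
  (forall A, measurable A ->
    \int[P]_w (H w * \1_A (Y w))%:E = c%:E * P (Y @^-1` A)) ->
  \int[P]_w (H w * g (Y w))%:E = c%:E * \int[P]_w (g (Y w))%:E.
Proof.
move=> mY mH H0 mg g0 ind.
have mYA A : measurable A -> measurable (Y @^-1` A).
  by move=> mA; rewrite -(setTI (_ @^-1` _)); exact: mY.
have simple (h : {nnsfun T1 >-> R}) :
    \int[P]_w (H w * h (Y w))%:E = c%:E * \int[P]_w (h (Y w))%:E.
  pose s := finmap.enum_fset (fset_set (range h)); pose B r := h @^-1` [set r].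
  have mB r : measurable (B r) by exact: measurable_sfunP.
  have hE x : h x = (\sum_(r <- s) r * \1_(B r) x)%R.
    by rewrite [LHS]fimfunE fsbig_finite.
  have B0 r x : (0 <= r * \1_(B r) x)%R.
    rewrite indicE; have [|] := boolP (x \in B r); last by rewrite mulr0.
    by rewrite inE => <-; rewrite mulr1.
  have m1 r : measurable_fun setT (fun w => \1_(B r) (Y w) : R)%R.
    by apply: measurableT_comp => //; exact: measurable_indic.
  under eq_integral => w _ do rewrite hE mulr_sumr -sumEFin.
  rewrite ge0_integral_sum//; last 2 first.
  - move=> r; apply/measurable_EFinP; apply: measurable_funM => //.
    exact: measurable_funM.
  - by move=> r w _; rewrite lee_fin mulr_ge0.
  under [in RHS]eq_integral => w _ do rewrite hE -sumEFin.
  rewrite ge0_integral_sum//; last 2 first.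
  - by move=> r; apply/measurable_EFinP; exact: measurable_funM.
  - by move=> r w _; rewrite lee_fin.
  rewrite ge0_sume_distrr; last first.
    by move=> r _; apply: integral_ge0 => w _; rewrite lee_fin.
  (* The scalar [r] leaves the integral only if it is nonnegative; a negative level is never
     attained by [h], and both sides vanish. *)
  apply: eq_bigr => r _; have [r0|r0] := ltP r 0%R.
    have z x : (\1_(B r) x = 0 :> R)%R.
      rewrite indicE; case: (boolP (x \in B r)) => //.
      rewrite inE => hx; have : (0 <= h x)%R by [].
      by rewrite hx leNgt r0.
    under eq_integral do rewrite z !mulr0.
    under [in RHS]eq_integral do rewrite z !mulr0.
    by rewrite integral0 mule0.
  under eq_integral do rewrite mulrCA EFinM.
  rewrite ge0_integralZl_EFin//; last 2 first.
  - by move=> w _; rewrite lee_fin mulr_ge0.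
  - by apply/measurable_EFinP; exact: measurable_funM.
  under [in RHS]eq_integral do rewrite EFinM.
  rewrite [in RHS]ge0_integralZl_EFin//; last by apply/measurable_EFinP.
  rewrite ind// muleCA; congr (_ * (_ * _)).
  by rewrite (_ : (fun w => _) = (fun w =>
    (\1_(Y @^-1` B r) w)%:E))// integral_indic ?setIT//; exact: mYA.
have mgE : measurable_fun setT (EFin \o g) by exact/measurable_EFinP.
pose h := nnsfun_approx measurableT mgE.
have cvh x : (h n x)%:E @[n --> \oo] --> (g x)%:E.
  by apply: (cvg_nnsfun_approx measurableT mgE) => // y _; rewrite lee_fin.
have ndh x m n : (m <= n)%N -> (h m x <= h n x)%R.
  by move=> mn; exact/lefP/(nd_nnsfun_approx measurableT mgE).
have mhY n : measurable_fun setT (fun w => h n (Y w)).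
  by apply: measurableT_comp.
have -> : \int[P]_w (H w * g (Y w))%:E = limn (fun n => \int[P]_w (H w * h n (Y w))%:E).
  rewrite -monotone_convergence//; last 3 first.
  - by move=> n; apply/measurable_EFinP; exact: measurable_funM.
  - by move=> n w _; rewrite lee_fin mulr_ge0.
  - by move=> w _ m n mn; rewrite lee_fin ler_wpM2l// ndh.
  apply: eq_integral => w _; apply/esym/cvg_lim => //.
  rewrite EFinM; under eq_fun do rewrite EFinM.
  by apply: cvgeZl => //; exact: cvh.
have -> : \int[P]_w (g (Y w))%:E = limn (fun n => \int[P]_w (h n (Y w))%:E).
  rewrite -monotone_convergence//; last 3 first.
  - by move=> n; apply/measurable_EFinP.
  - by move=> n w _; rewrite lee_fin.
  - by move=> w _ m n mn; rewrite lee_fin ndh.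
  by apply: eq_integral => w _; apply/esym/cvg_lim => //; exact: cvh.
rewrite -limeMl//; last first.
  apply: ereal_nondecreasing_is_cvgn => m n mn; apply: ge0_le_integral => //.
  - by move=> w _; rewrite lee_fin.
  - by apply/measurable_EFinP.
  - by apply/measurable_EFinP.
  - by move=> w _; rewrite lee_fin ndh.
by congr (limn _); apply/funext => n; exact: simple.
Qed.


Lemma mutually_indep_integral_prod n d1 (T1 : measurableType d1)
    (U : 'I_n -> T -> T1) (g : 'I_n -> T1 -> R) (e : 'I_n -> R) :
  (forall i, measurable_fun setT (U i)) -> mutually_indep P U ->
  (forall i, measurable_fun setT (g i)) -> (forall i x, (0 <= g i x)%R) ->
  (forall i, \int[P]_w (g i (U i w))%:E = (e i)%:E) ->
  \int[P]_w (\prod_i g i (U i w))%:E = (\prod_i e i)%:E.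
Proof.
move=> mU indU mg g0 ge.
have mUA i A : measurable A -> measurable (U i @^-1` A).
  by move=> mA; rewrite -(setTI (_ @^-1` _)); exact: mU.
(* Independence is the case of indicators of the [A i]; they are replaced by the
   [g i] one index at a time. *)
pose f (A : 'I_n -> set T1) k (i : 'I_n) (x : T1) : R :=
  if (i < k)%N then g i x else \1_(A i) x.
pose c (A : 'I_n -> set T1) k (i : 'I_n) : R :=
  if (i < k)%N then e i else fine (P (U i @^-1` A i)).
have mf A k i : (forall i, measurable (A i)) ->
  measurable_fun setT (fun w => f A k i (U i w)).
  move=> mA; rewrite /f; case: (i < k)%N; apply: measurableT_comp => //.
have f0 A k i x : (0 <= f A k i x)%R by rewrite /f; case: ifP.
suff main k A : (k <= n)%N -> (forall i, measurable (A i)) ->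
    \int[P]_w (\prod_i f A k i (U i w))%:E = (\prod_i c A k i)%:E.
  have := main n (fun=> setT) (leqnn _) (fun=> measurableT).
  under eq_integral => w _ do under eq_bigr => i _ do rewrite /f ltn_ord.
  by under [in RHS]eq_bigr => i _ do rewrite /c ltn_ord.
elim: k A => [|k IH] A kn mA.
  have -> : (\prod_i c A 0 i)%:E = \prod_i P (U i @^-1` A i).
    rewrite -prodEFin; apply: eq_bigr => i _ /=.
    by rewrite /c ltn0 fineK// fin_num_measure//; exact: mUA.
  rewrite -(indU _ mA).
  have mI : measurable (\bigcap_i (U i @^-1` A i)).
    by apply: fin_bigcap_measurable => // i _; exact: mUA.
  rewrite -[in RHS](setIT (\bigcap_i _)) -integral_indic//; apply: eq_integral => w _.
  congr (_%:E); rewrite /f indicE; have [/[!inE] h|/negP h] := boolP (w \in _).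
    rewrite big1// => i _; rewrite indicE mem_set//; exact: h.
  apply/eqP; rewrite prodf_seq_eq0; apply: contrapT => /negP/hasPn h2.
  apply: h; rewrite inE => i _.
  have := h2 i (mem_index_enum _).
  by rewrite /= indicE; case: (boolP (_ \in _)) => //; rewrite ?inE// => _;
    rewrite eqxx.
pose i0 := Ordinal kn.
under eq_integral => w _ do rewrite (bigD1 i0)//= mulrC.
rewrite (bigD1 i0)//= mulrC EFinM.
have -> : (c A k.+1 i0)%:E = \int[P]_w (f A k.+1 i0 (U i0 w))%:E.
  by rewrite /c /f ltnS leqnn -ge.
have fk i : i != i0 -> f A k.+1 i = f A k i.
  move=> ii0; apply/funext => x; rewrite /f ltnS leq_eqVlt.
  by have /negbTE -> : (i != k :> nat) by [].
have ck i : i != i0 -> c A k.+1 i = c A k i.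
  move=> ii0; rewrite /c ltnS leq_eqVlt.
  by have /negbTE -> : (i != k :> nat) by [].
apply: ge0_integralM_indep => //.
- under eq_fun do rewrite -big_filter.
  by apply: measurable_prod => i _; exact: mf.
- by move=> w; apply: prodr_ge0.
- by rewrite /f ltnS leqnn.
(* The induction hypothesis is used for the family with [A i0] replaced by [B]: its factor at [i0]
   is then the indicator of [B], against which the remaining product has to be tested. *)
move=> B mB; pose A' i := if i == i0 then B else A i.
have := IH A' (ltnW kn) (fun i => _).
rewrite (bigD1 i0)//= [c _ _ _]/c ltnn /A' eqxx EFinM fineK; last first.
  by rewrite fin_num_measure//; exact: mUA.
under eq_integral => w _ do rewrite (bigD1 i0)//= /f ltnn eqxx mulrC.
rewrite -/A' => IHe; rewrite muleC.
rewrite (_ : \prod_(i < n | i != i0) c A k.+1 i =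
  \prod_(i < n | i != i0) c A' k i)%R; last first.
  by apply: eq_bigr => i ii0; rewrite ck// /c /A' (negbTE ii0).
rewrite -IHe; last by move=> i; rewrite /A'; case: ifP.
apply: eq_integral => w _; congr ((_ * _)%:E).
by apply: eq_bigr => i ii0; rewrite fk// /f /A' (negbTE ii0).
Qed.

Lemma mutually_indep_integral_prod_le n d1 (T1 : measurableType d1)
    (U : 'I_n -> T -> T1) (g : 'I_n -> T1 -> R) (M : 'I_n -> R) :
  (forall i, measurable_fun setT (U i)) -> mutually_indep P U ->
  (forall i, measurable_fun setT (g i)) -> (forall i x, (0 <= g i x)%R) ->
  (forall i, \int[P]_w (g i (U i w))%:E <= (M i)%:E) ->
  \int[P]_w (\prod_i g i (U i w))%:E <= (\prod_i M i)%:E.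
Proof.
move=> mU indU mg g0 gM.
have I0 i : 0 <= \int[P]_w (g i (U i w))%:E.
  by apply: integral_ge0 => w _; rewrite lee_fin.
have fE i : \int[P]_w (g i (U i w))%:E = (fine (\int[P]_w (g i (U i w))%:E))%:E.
  by rewrite fineK// ge0_fin_numE// (le_lt_trans (gM i))// ltry.
rewrite (mutually_indep_integral_prod mU indU mg g0 fE) lee_fin.
apply: ler_prod => i _; rewrite fine_ge0//= -lee_fin -fE; exact: gM.
Qed.

End independence.

Section concentration.
Local Open Scope ereal_scope.
Context d (T : measurableType d) (R : realType) (P : probability T R).

Lemma measurable_set_ler (f g : T -> R) : measurable_fun setT f ->
  measurable_fun setT g -> measurable [set w | (f w <= g w)%R].
Proof.
move=> mf mg; rewrite -[X in measurable X]setTI.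
rewrite (_ : [set w | _] = (fun w => (f w <= g w)%R) @^-1` [set true]).
  by apply: (measurable_fun_ler mf mg).
by apply/seteqP; split => w /= ->.
Qed.

Lemma measurable_set_ltr (f g : T -> R) : measurable_fun setT f ->
  measurable_fun setT g -> measurable [set w | (f w < g w)%R].
Proof.
move=> mf mg; rewrite -[X in measurable X]setTI.
rewrite (_ : [set w | _] = (fun w => (f w < g w)%R) @^-1` [set true]).
  by apply: (measurable_fun_ltr mf mg).
by apply/seteqP; split => w /= ->.
Qed.

Lemma ge0_markov (f : T -> R) (c : R) : measurable_fun setT f ->
  (forall w, 0 <= f w)%R -> (0 <= c)%R ->
  c%:E * P [set w | (c <= f w)%R] <= \int[P]_w (f w)%:E.
Proof.
move=> mf f0 c0.
have mA : measurable [set w | (c <= f w)%R].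
  exact: measurable_set_ler.
rewrite -[[set w | _] in leLHS]setIT -integral_indic// -ge0_integralZl_EFin//;
  last first.
  by apply/measurable_EFinP; exact: measurable_indic.
apply: ge0_le_integral => //.
- by move=> w _; rewrite -EFinM lee_fin mulr_ge0.
- by under eq_fun do rewrite -EFinM; apply/measurable_EFinP;
  apply: measurable_funM => //; exact: measurable_indic.
- exact/measurable_EFinP.
move=> w _; rewrite -EFinM lee_fin indicE; case: (boolP (w \in _)) => [|_].
  by rewrite inE/= mulr1.
by rewrite mulr0.
Qed.

Lemma chernoff_ge (f : T -> R) (a m : R) : measurable_fun setT f ->
  \int[P]_w (expR (f w))%:E <= (expR m)%:E ->
  P [set w | (a <= f w)%R] <= (expR (m - a))%:E.
Proof.
move=> mf fm.
have me : measurable_fun setT (fun w => expR (f w)).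
  by apply: measurableT_comp => //; exact: measurable_expR.
have := le_trans (ge0_markov me (fun w => expR_ge0 (f w)) (expR_ge0 a)) fm.
have -> : [set w | (expR a <= expR (f w))%R] = [set w | (a <= f w)%R].
  by apply/seteqP; split => w /=; rewrite ler_expR.
by rewrite expRB [(expR m / _)%R]mulrC EFinM lee_pdivlMl ?expR_gt0.
Qed.

Lemma chernoff_sum n d1 (T1 : measurableType d1) (U : 'I_n -> T -> T1)
    (h : 'I_n -> T1 -> R) (m a : R) :
  (forall i, measurable_fun setT (U i)) -> mutually_indep P U ->
  (forall i, measurable_fun setT (h i)) ->
  (forall i, \int[P]_w (expR (h i (U i w)))%:E <= (expR m)%:E) ->
  P [set w | (a <= \sum_i h i (U i w))%R] <= (expR (n%:R * m - a))%:E.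
Proof.
move=> mU indU mh hm; apply: chernoff_ge.
  by apply: measurable_sum => i; exact: measurableT_comp.
under eq_integral do rewrite expR_sum.
have -> : expR (n%:R * m) = (\prod_(i < n) expR m)%R.
  by rewrite prodr_const card_ord expRM_natl.
apply: (mutually_indep_integral_prod_le (g := fun i x => expR (h i x))) => //.
by move=> i; apply: measurableT_comp => //; exact: measurable_expR.
Qed.

(** Conditioning on [V] without conditional expectations: independence makes the joint law the
    product law, and Tonelli integrates over [U] with the value of [V] frozen. *)
Lemma indep2_integral_le d1 d2 (T1 : measurableType d1) (T2 : measurableType d2)
    (U : {RV P >-> T1}) (V : {RV P >-> T2}) (f : T2 * T1 -> R) (c : R) :
  indep2 P U V -> measurable_fun setT f -> (forall z, 0 <= f z)%R ->
  (forall y, \int[P]_w (f (y, U w))%:E <= c%:E) ->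
  \int[P]_w (f (V w, U w))%:E <= c%:E.
Proof.
move=> UV mf f0 fc.
pose W w := (V w, U w).
have mW : measurable_fun setT W by exact: measurable_fun_pair.
pose Wp : {mfun T >-> (T2 * T1)%type} := HB.pack W (isMeasurableFun.Build _ _ _ _ _ mW).
have mfE : measurable_fun setT (EFin \o f) by exact/measurable_EFinP.
have f0E z : 0 <= (EFin \o f) z by rewrite lee_fin.
have -> : \int[P]_w (f (V w, U w))%:E = \int[distribution P Wp]_z (EFin \o f) z.
  by rewrite ge0_integral_distribution.
rewrite (eq_measure_integral (distribution P V \x distribution P U)); last first.
  move=> A mA _; apply/esym.
  apply: (product_measure_unique (m' := distribution P Wp)) => // B C mB mC.
  rewrite /distribution /pushforward/= muleC -UV//; congr (P _).
  by apply/seteqP; split => w [].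
rewrite fubini_tonelli1//; apply: (@le_trans _ _ (\int[distribution P V]_y c%:E)).
  apply: ge0_le_integral => //.
  - by move=> y _; apply: integral_ge0 => x _.
  - exact: measurable_fun_fubini_tonelli_F.
  move=> y _; rewrite /fubini_F ge0_integral_distribution//; first exact: fc.
  by apply: measurableT_comp => //; exact: measurable_pair1.
by rewrite integral_cst//= probability_setT mule1.
Qed.

End concentration.

(** * Quadratic forms and extreme eigenvalues *)

Section dot_product.
Context {R : realType}.

Lemma dotv_mulmx m (u v : 'cV[R]_m) : dotv u v = (u^T *m v) 0 0.
Proof. by rewrite mxE; apply: eq_bigr => i _; rewrite mxE. Qed.

Lemma dotvC m (u v : 'cV[R]_m) : dotv u v = dotv v u.
Proof. by apply: eq_bigr => i _; rewrite mulrC. Qed.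

Lemma dotvDl m (u u' v : 'cV[R]_m) : dotv (u + u') v = dotv u v + dotv u' v.
Proof. by rewrite !dotv_mulmx linearD/= mulmxDl mxE. Qed.

Lemma dotvDr m (u v v' : 'cV[R]_m) : dotv u (v + v') = dotv u v + dotv u v'.
Proof. by rewrite !dotv_mulmx mulmxDr mxE. Qed.

Lemma dotvZl m (a : R) (u v : 'cV[R]_m) : dotv (a *: u) v = a * dotv u v.
Proof. by rewrite !dotv_mulmx linearZ/= -scalemxAl mxE. Qed.

Lemma dotvZr m (a : R) (u v : 'cV[R]_m) : dotv u (a *: v) = a * dotv u v.
Proof. by rewrite dotvC dotvZl dotvC. Qed.

Lemma dotvNl m (u v : 'cV[R]_m) : dotv (- u) v = - dotv u v.
Proof. by rewrite -scaleN1r dotvZl mulN1r. Qed.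

Lemma dotvNr m (u v : 'cV[R]_m) : dotv u (- v) = - dotv u v.
Proof. by rewrite dotvC dotvNl dotvC. Qed.

Lemma dotv0r m (u : 'cV[R]_m) : dotv u 0 = 0.
Proof. by rewrite -[0 in LHS](scale0r (0 : 'cV[R]_m)) dotvZr mul0r. Qed.

Lemma dotv_mulmxr m n (A : 'M[R]_(m, n)) (u : 'cV[R]_m) (v : 'cV[R]_n) :
  dotv u (A *m v) = dotv (A^T *m u) v.
Proof. by rewrite !dotv_mulmx trmx_mul trmxK mulmxA. Qed.

Lemma dotvv_ge0 m (v : 'cV[R]_m) : 0 <= dotv v v.
Proof. by apply: sumr_ge0 => i _; rewrite -expr2 sqr_ge0. Qed.

Lemma sqr_l2norm m (v : 'cV[R]_m) : l2norm v ^+ 2 = dotv v v.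
Proof.
have E : \sum_i v i 0 ^+ 2 = dotv v v by apply: eq_bigr => i _; rewrite expr2.
by rewrite /l2norm E sqr_sqrtr ?dotvv_ge0.
Qed.

Lemma dotvv_eq0 m (v : 'cV[R]_m) : dotv v v = 0 -> v = 0.
Proof.
move=> /eqP; rewrite psumr_eq0; last by move=> i _; rewrite -expr2 sqr_ge0.
move=> /allP h; apply/matrixP => i k; rewrite ord1 mxE.
by have := h i (mem_index_enum _); rewrite -expr2 sqrf_eq0 => /eqP.
Qed.

Lemma dotvv_gt0 m (v : 'cV[R]_m) : v != 0 -> 0 < dotv v v.
Proof.
by move=> v0; rewrite lt_neqAle dotvv_ge0 andbT eq_sym;
  apply: contra v0 => /eqP/dotvv_eq0/eqP.
Qed.

Lemma dotv_deltal m (k : 'I_m) (v : 'cV[R]_m) : dotv (delta_mx k 0) v = v k 0.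
Proof.
rewrite /dotv (bigD1 k)//= big1 ?addr0 => [|i ik]; first by rewrite mxE !eqxx mul1r.
by rewrite mxE (negbTE ik) mul0r.
Qed.

Lemma mulmx_delta n p (X : 'M[R]_(n, p)) k : X *m delta_mx k 0 = col k X.
Proof. by rewrite -colE. Qed.

Lemma cauchy_schwarz_dotv m (u v : 'cV[R]_m) : dotv u v ^+ 2 <= dotv u u * dotv v v.
Proof.
have [->|v0] := eqVneq v 0; first by rewrite !dotv0r mulr0 expr0n.
have vp := dotvv_gt0 v0.
have := dotvv_ge0 (dotv v v *: u - dotv u v *: v).
rewrite dotvDl !dotvDr !dotvNl !dotvNr !dotvZl !dotvZr (dotvC v u).
by move=> h; rewrite -(ler_pM2l vp); move: h; lra.
Qed.

(** First-order optimality without derivatives: divide by [t] and let it tend to 0. Perturbing a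
    minimiser of a quadratic objective along a direction produces such an inequality. *)
Lemma ge0_slope (b c : R) : (forall t, 0 < t <= 1 -> 0 <= t * b + t ^+ 2 * c) -> 0 <= b.
Proof.
move=> h; rewrite leNgt; apply/negP => b0.
(* For this [t], [t c <= - b / 2], so the quadratic term cannot compensate the negative linear
   one. *)
pose t := Num.min 1 (- b / (2 * (`|c| + 1))).
have c1 : 0 < 2 * (`|c| + 1) by rewrite mulr_gt0// ltr_wpDl.
have t0 : 0 < t by rewrite lt_min ltr01 divr_gt0// oppr_gt0.
have t1 : t <= 1 by rewrite ge_min lexx.
have := h t; rewrite t0 t1 => /(_ isT); apply/negP; rewrite -ltNge.
have t2 : t * (2 * (`|c| + 1)) <= - b.
  by rewrite -ler_pdivlMr// ge_min lexx orbT.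
have := ler_norm c; nra.
Qed.

(** A zero of a nonnegative form minimises it. Moving from [v] along [- A *m v] has first-order
    effect [- 2 |A v|_2^2], which must be nonnegative. *)
Lemma psd_kernel m (A : 'M[R]_m) (v : 'cV[R]_m) : A^T = A ->
  (forall x, 0 <= dotv x (A *m x)) -> dotv v (A *m v) = 0 -> A *m v = 0.
Proof.
move=> Asym psd v0; apply: dotvv_eq0; set w := A *m v.
apply/eqP; rewrite eq_le dotvv_ge0 andbT.
suff : 0 <= - (2 * dotv w w) by lra.
apply: (@ge0_slope _ (dotv w (A *m w))) => t _.
have := psd (v - t *: w); rewrite -/w.
rewrite mulmxBr -scalemxAr dotvDl !dotvDr !dotvNl !dotvNr !dotvZl !dotvZr -/w.
have e1 : dotv v w = 0 by [].
have e2 : dotv v (A *m w) = dotv w w by rewrite dotv_mulmxr Asym.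
rewrite e1 e2; lra.
Qed.

End dot_product.

(** * Extreme eigenvalues and the Rayleigh quotient *)

Section rayleigh.
Context {R : realType}.

Lemma continuous_bigsum (T : topologicalType) (I : Type) (s : seq I)
    (F : I -> T -> R) :
  (forall i, continuous (F i)) -> continuous (fun v => \sum_(i <- s) F i v).
Proof.
move=> cF; elim: s => [|i s IH].
  by under eq_fun do rewrite big_nil; exact: cst_continuous.
under eq_fun do rewrite big_cons.
by move=> x; apply: cvgD; [exact: cF|exact: IH].
Qed.

(** The form attains its minimum [a] on the compact unit sphere. The minimiser is a zero of the
    nonnegative form of [A - a%:M], hence in its kernel: an eigenvector for [a]. *)
Lemma exists_min_eigenvalue p (A : 'M[R]_p.+1) : A^T = A ->
  exists2 a, eigenvalue A a & forall v : 'cV_p.+1, a * dotv v v <= dotv v (A *m v).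
Proof.
move=> Asym.
pose q (B : 'M[R]_p.+1) (v : 'rV[R]_p.+1) := \sum_i v 0 i * \sum_j B i j * v 0 j.
have qE B v : q B v^T = dotv v (B *m v).
  apply: eq_bigr => i _; rewrite !mxE; congr (_ * _).
  by apply: eq_bigr => k _; rewrite mxE.
have cc i : continuous (fun v : 'rV[R]_p.+1 => v 0 i) by exact: coord_continuous.
have cq B : continuous (q B).
  apply: (@continuous_bigsum _ _ _ (fun i (v : 'rV[R]_p.+1) =>
    v 0 i * \sum_j B i j * v 0 j)) => i v.
  apply: continuousM; first exact: cc.
  apply: (@continuous_bigsum _ _ _ (fun k (v : 'rV[R]_p.+1) => B i k * v 0 k)) => k x.
  by apply: continuousM; [exact: cst_continuous|exact: cc].
have q1 v : q 1%:M v = \sum_i v 0 i ^+ 2.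
  apply: eq_bigr => i _; rewrite (bigD1 i)//= mxE eqxx mul1r big1 ?addr0 ?expr2//.
  by move=> k ki; rewrite mxE eq_sym (negbTE ki) mul0r.
pose S := [set v : 'rV[R]_p.+1 | q 1%:M v = 1].
have cB := @rV_compact R p.+1 (fun=> `[(- 1),
  1]%classic) (fun=> @segment_compact R (- 1) 1).
have cS : compact S.
  apply: (subclosed_compact _ cB).
  - have := @closed_comp _ _ (q 1%:M) [set 1].
    by apply => [v _|]; [exact: cq|exact: closed_eq].
  move=> v; rewrite /S/= q1 => sv i.
  rewrite in_itv/= -ler_norml -(@ler_pXn2r _ 2)// ?nnegrE//.
  rewrite expr1n -sv real_normK ?num_real// (bigD1 i)//= lerDl.
  by apply: sumr_ge0 => k _; exact: sqr_ge0.
have S0 : S !=set0.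
  exists (delta_mx 0 0); rewrite /S/= q1 (bigD1 0)//= mxE !eqxx expr1n big1 ?addr0//.
  by move=> k k0; rewrite mxE eqxx (negbTE k0) expr0n.
have [v0 Sv0 minv0] := EVT_min_rV S0 cS (continuous_subspaceT (cq A)).
have v01 : dotv v0^T v0^T = 1.
  by move: Sv0; rewrite /S inE/= -[v0]trmxK qE mul1mx trmxK.
pose a := dotv v0^T (A *m v0^T).
have qmin v : a * dotv v v <= dotv v (A *m v).
  have [->|vn0] := eqVneq v 0; first by rewrite mulmx0 !dotv0r mulr0.
  have vp := dotvv_gt0 vn0.
  pose r := Num.sqrt (dotv v v).
  have r0 : 0 < r by rewrite sqrtr_gt0.
  have r2 : r ^+ 2 = dotv v v by rewrite sqr_sqrtr// ltW.
  have := minv0 (r^-1 *: v)^T; rewrite qE -{1}[v0]trmxK qE -/a.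
  rewrite -scalemxAr dotvZl dotvZr => h.
  have {}h : a <= r^-1 * (r^-1 * dotv v (A *m v)).
    apply: h; rewrite /S inE/= qE mul1mx dotvZl dotvZr -r2.
    by field; rewrite gt_eqF.
  rewrite -ler_pdivlMr// -r2; apply: le_trans h _.
  by rewrite mulrA -invfM -expr2 mulrC.
exists a => //.
have psdA x : 0 <= dotv x ((A - a%:M) *m x).
  by rewrite mulmxBl dotvDr dotvNr mul_scalar_mx dotvZr subr_ge0.
have Bsym : (A - a%:M)^T = A - a%:M by rewrite linearB/= tr_scalar_mx Asym.
have := psd_kernel (v := v0^T) Bsym psdA.
rewrite mulmxBl dotvDr dotvNr mul_scalar_mx dotvZr v01 mulr1 -/a subrr => /(_ erefl).
move=> /eqP; rewrite subr_eq0 => /eqP Av.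
apply/eigenvalueP; exists v0.
  by apply: trmx_inj; rewrite trmx_mul Asym Av linearZ.
by apply: contra_eq_neq v01 => ->; rewrite trmx0 dotv0r eq_sym oner_neq0.
Qed.

(** The Rayleigh minimum is an eigenvalue and bounds all the others from below, so the infimum is
    taken over a nonempty set that is bounded below. In dimension 0 there is no eigenvalue, and both
    sides are 0. *)
Lemma Lambda_min_le p (A : 'M[R]_p) (v : 'cV[R]_p) : A^T = A ->
  Lambda_min A * dotv v v <= dotv v (A *m v).
Proof.
case: p A v => [|p] A v Asym; first by rewrite /dotv !big_ord0 mulr0.
 have [a ea amin] := exists_min_eigenvalue Asym.
apply: le_trans (amin v); rewrite ler_wpM2r ?dotvv_ge0//.
apply: ge_inf => //; exists a => b /= /eigenvalueP[u uA u0].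
have Au : A *m u^T = b *: u^T by rewrite -{1}Asym -trmx_mul uA linearZ.
have := amin u^T; rewrite Au dotvZr ler_pM2r// dotvv_gt0//.
by apply: contra u0 => /eqP/(congr1 trmx); rewrite trmxK trmx0 => ->.
Qed.

Lemma Lambda_max_ge p (A : 'M[R]_p) (v : 'cV[R]_p) : A^T = A ->
  dotv v (A *m v) <= Lambda_max A * dotv v v.
Proof.
case: p A v => [|p] A v Asym; first by rewrite /dotv !big_ord0 mulr0.
 have NAsym : (- A)^T = - A by rewrite linearN/= Asym.
have [a ea amin] := exists_min_eigenvalue NAsym.
have le_a x : dotv x (A *m x) <= - a * dotv x x.
  by have := amin x; rewrite mulNmx dotvNr; lra.
apply: le_trans (le_a v) _; rewrite ler_wpM2r ?dotvv_ge0//.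
apply: ub_le_sup; last first.
  move/eigenvalueP: ea => [u uA u0]; apply/eigenvalueP; exists u => //.
  by rewrite scaleNr -uA mulmxN opprK.
exists (- a) => b /= /eigenvalueP[u uA u0].
have Au : A *m u^T = b *: u^T by rewrite -{1}Asym -trmx_mul uA linearZ.
have := le_a u^T; rewrite Au dotvZr ler_pM2r// dotvv_gt0//.
by apply: contra u0 => /eqP/(congr1 trmx); rewrite trmxK trmx0 => ->.
Qed.

End rayleigh.

(** * Tails of a sub-Gaussian design *)

Lemma delta_cV_neq0 (R : realType) m (k : 'I_m) : delta_mx k 0 != 0 :> 'cV[R]_m.
Proof. by apply/eqP => /matrixP/(_ k 0)/eqP; rewrite !mxE !eqxx/= oner_eq0. Qed.

Section inverse_square_root.
Context {R : realType} (p : nat) (Sigma B : 'M[R]_p) (SB : is_inv_sqrtmx Sigma B).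

Lemma is_inv_sqrtmx_sym : Sigma^T = Sigma.
Proof.
have [Su [Bsym _] BB] := SB.
have BBsym : (invmx Sigma)^T = invmx Sigma by rewrite -BB trmx_mul Bsym.
by rewrite -[in LHS](invmxK Sigma) trmx_inv BBsym invmxK.
Qed.

(** [b] is the normalisation of [v := invmx B *m u], and [|v|_2^2 = <u, Sigma u>]. So a linear
    functional of a row is a one-dimensional marginal of the whitened row times its standard
    deviation. *)
Lemma is_inv_sqrtmx_sphere (u : 'cV[R]_p) : u != 0 ->
  exists2 b, dotv u (Sigma *m u) > 0 /\ l2norm b = 1 &
    forall x, dotv u x = Num.sqrt (dotv u (Sigma *m u)) * dotv (B *m x) b.
Proof.
move=> u0; have [Su [Bsym _] BB] := SB.
have Bu : B \in unitmx.
  have : invmx Sigma \in unitmx by rewrite unitmx_inv.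
  by rewrite -BB unitmx_mul => /andP[].
pose v := invmx B *m u.
have uE : u = B *m v by rewrite mulmxA mulmxV// mul1mx.
have v0 : v != 0 by apply: contra u0 => /eqP v0; rewrite uE v0 mulmx0.
have BSB : B *m (Sigma *m B) = 1%:M.
  by apply: mulmx1C; rewrite -mulmxA BB mulmxV.
have qE : dotv u (Sigma *m u) = dotv v v.
  by rewrite uE -{1}Bsym -dotv_mulmxr !mulmxA -[B *m _ *m _]mulmxA BSB mul1mx.
have vp := dotvv_gt0 v0.
set r := Num.sqrt _; have r0 : 0 < r by rewrite /r sqrtr_gt0 qE.
have r2 : r ^+ 2 = dotv v v by rewrite sqr_sqrtr qE// ltW.
exists (r^-1 *: v).
  rewrite qE; split => //; apply/eqP; rewrite -(eqrXn2 (n := 2))// ?sqrtr_ge0//.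
  by rewrite sqr_l2norm dotvZl dotvZr -r2 expr1n; apply/eqP; field; rewrite gt_eqF.
move=> x; rewrite dotvZr mulrA divff ?gt_eqF// mul1r dotvC {1}uE.
by rewrite (dotvC (B *m x)) dotv_mulmxr Bsym dotvC.
Qed.

End inverse_square_root.

Section design.
Local Open Scope ereal_scope.
Context d (T : measurableType d) (R : realType) (P : probability T R).
Context (n p : nat) (X : {RV P >-> n.-tuple (p.-tuple R)}) (Sigma : 'M[R]_p).
Context (Cmin Cmax K1 K : R).
Hypothesis designX : subgaussian_design X Sigma Cmin Cmax K1.
Hypotheses (K_gt0 : (0 < K)%R) (K1K : (K1 <= K)%R).

Let q (u : 'cV[R]_p) := dotv u (Sigma *m u).
Let lin (u : 'cV[R]_p) (t : p.-tuple R) := dotv u (col_of_tuple t).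

Lemma measurable_lin u : measurable_fun setT (lin u).
Proof.
apply: measurable_sum => k; apply: measurable_funM => //.
under eq_fun do rewrite mxE; exact: measurable_tnth.
Qed.

Lemma measurable_row i : measurable_fun setT (fun w => tnth (X w) i).
Proof. by apply: (measurableT_comp (measurable_tnth i)). Qed.

Lemma measurable_lin_row u i : measurable_fun setT (fun w => lin u (tnth (X w) i)).
Proof. by apply: (measurableT_comp (measurable_lin u)); exact: measurable_row. Qed.

Lemma design_sym : Sigma^T = Sigma.
Proof. by have [_ _ _ _ [B SB _]] := designX; exact: is_inv_sqrtmx_sym SB. Qed.

Lemma design_qform_gt0 u : u != 0%R -> (0 < q u)%R.
Proof.
by move=> u0; have [_ _ _ _ [B SB _]] := designX;
  have [b []] := is_inv_sqrtmx_sphere SB u0.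
Qed.

Lemma design_qform_ge u : (Cmin * dotv u u <= q u)%R.
Proof.
have [_ _ _ [c1 _ _] _] := designX.
by apply: le_trans (Lambda_min_le u design_sym); rewrite ler_wpM2r// dotvv_ge0.
Qed.

Lemma design_qform_le u : (q u <= Cmax * dotv u u)%R.
Proof.
have [_ _ _ [_ _ c2] _] := designX.
by apply: le_trans (Lambda_max_ge u design_sym) _; rewrite ler_wpM2r// dotvv_ge0.
Qed.

(** The parameter is proportional to the variance [q u]. This makes the tail exponents below
    independent of [u], as a union bound over many [u] requires. *)
Lemma design_subgaussian u i : u != 0%R ->
  subgaussian_moments P (fun w => lin u (tnth (X w) i)) (K ^+ 2 * q u).
Proof.
move=> u0; have [_ _ _ _ [B SB psiX]] := designX.
have [b [q0 b1] linE] := is_inv_sqrtmx_sphere SB u0.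
have psib : psi2 P (fun w => dotv (B *m col_of_tuple (tnth (X w) i)) b) <= K%:E.
  apply: (@le_trans _ _ K1%:E); last by rewrite lee_fin.
  by apply: le_trans (psiX i); apply: ereal_sup_ubound; exists b.
have := psi2_subgaussian_moments (ltW K_gt0) psib.
move=> /(subgaussian_momentsZ (Num.sqrt (q u))).
rewrite sqr_sqrtr ?(ltW q0)// mulrC => h.
under eq_fun do rewrite /lin linE; apply: h.
apply: (@measurable_sum _ _ _ _ _ _ (fun k w =>
  (B *m col_of_tuple (tnth (X w) i)) k 0 * b k 0)%R) => k.
apply: measurable_funM => //; under eq_fun do rewrite mxE.
apply: measurable_sum => l; apply: measurable_funM => //.
under eq_fun do rewrite mxE.
by apply: (measurableT_comp (measurable_tnth l)); exact: measurable_row.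
Qed.

Let entry i k w := tnth (tnth (X w) i) k.

Let entryE i k : entry i k = (fun w => lin (delta_mx k 0)%R (tnth (X w) i)).
Proof. by apply/funext => w; rewrite /lin dotv_deltal mxE. Qed.

Let measurable_entry i k : measurable_fun setT (entry i k).
Proof. by rewrite entryE; exact: measurable_lin_row. Qed.

Let entry_integrable i k : P.-integrable setT (EFin \o entry i k).
Proof.
rewrite entryE; apply: subgaussian_moments_integrable; first exact: measurable_lin_row.
by apply: design_subgaussian; exact: delta_cV_neq0.
Qed.

Let entry2_integrable i k : P.-integrable setT (EFin \o (fun w => entry i k w ^+ 2)%R).
Proof.
apply: (ge0_integrable (c := (1.*2%:R * (K ^+ 2 * q (delta_mx k 0)%R)) ^+ 1)).
- exact: measurable_funX.
- by move=> w; exact: sqr_ge0.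
- by rewrite entryE; apply: (design_subgaussian i (delta_cV_neq0 R k) 1%N).
Qed.

Let entryM_integrable i k l :
  P.-integrable setT (EFin \o (fun w => entry i k w * entry i l w)%R).
Proof.
have i2 : P.-integrable setT (EFin \o (fun w => entry i k w ^+ 2 + entry i l w ^+ 2)%R).
  have -> : EFin \o (fun w => entry i k w ^+ 2 + entry i l w ^+ 2)%R =
    (EFin \o (fun w => entry i k w ^+ 2)%R) \+ (EFin \o (fun w => entry i l w ^+ 2)%R).
    by apply/funext => w /=; rewrite EFinD.
  exact: integrableD.
apply: le_integrable i2 => //; first by apply/measurable_EFinP; exact: measurable_funM.
move=> w _ /=; rewrite lee_fin [leRHS]ger0_norm ?addr_ge0 ?sqr_ge0// normrM.
rewrite -(real_normK (num_real (entry i k w))) -(real_normK (num_real (entry i l w))).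
have := sqr_ge0 (`|entry i k w| - `|entry i l w|)%R; have := normr_ge0 (entry i k w).
have := normr_ge0 (entry i l w); nra.
Qed.

Lemma design_mean u i : \int[P]_w (lin u (tnth (X w) i))%:E = 0.
Proof.
have [_ E0 _ _ _] := designX.
have linE w : lin u (tnth (X w) i) = (\sum_k u k 0 * entry i k w)%R.
  by apply: eq_bigr => k _; rewrite mxE.
under eq_integral do rewrite linE -sumEFin.
rewrite integral_sum//; last first.
  move=> k; under eq_fun do rewrite EFinM.
  exact: (integrableZl measurableT (u k 0)%R (entry_integrable i k)).
rewrite big1// => k _; under eq_integral do rewrite EFinM.
have e0 : \int[P]_w (entry i k w)%:E = 0 by have := E0 i k; rewrite unlock.
by rewrite (integralZl measurableT (entry_integrable i k)) e0 mule0.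
Qed.

Lemma design_second_moment u i : \int[P]_w (lin u (tnth (X w) i) ^+ 2)%:E = (q u)%:E.
Proof.
have [_ E0 Ecov _ _] := designX.
have lin2E w : (lin u (tnth (X w) i) ^+ 2 =
    \sum_k \sum_l (u k 0 * u l 0) * (entry i k w * entry i l w))%R.
  rewrite expr2 mulr_suml; apply: eq_bigr => k _; rewrite mulr_sumr.
  by apply: eq_bigr => l _; rewrite !mxE /entry; ring.
under eq_integral do rewrite lin2E -sumEFin.
under eq_integral do under eq_bigr do rewrite -sumEFin.
have iM k l : P.-integrable setT (fun w =>
  ((u k 0 * u l 0) * (entry i k w * entry i l w))%:E).
  under eq_fun do rewrite EFinM.
  exact: (integrableZl measurableT (u k 0 * u l 0)%R (entryM_integrable i k l)).
rewrite integral_sum//; last first.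
  by move=> k; apply: integrable_sum.
rewrite /q /dotv -sumEFin; apply: eq_bigr => k _.
rewrite integral_sum// mxE mulr_sumr -sumEFin; apply: eq_bigr => l _.
under eq_integral do rewrite EFinM.
rewrite (integralZl measurableT (entryM_integrable i k l)) (_ : (u k 0 * (Sigma k
  l * u l 0) = u k 0 * u l 0 * Sigma k l)%R); last by ring.
rewrite [RHS]EFinM -(Ecov i k l); congr (_ * _).
rewrite unlock (E0 i k) (E0 i l) unlock; apply: eq_integral => w _ /=.
rewrite -[RHS]/(((entry i k w - 0) * (entry i l w - 0))%:E)%R; by rewrite !subr0.
Qed.

Lemma design_expR u i (a : R) : u != 0%R ->
  \int[P]_w (expR (a * lin u (tnth (X w) i)))%:E <=
    (expR (36 * (K ^+ 2 * q u) * a ^+ 2))%:E.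
Proof.
move=> u0; apply: integral_expR_le;
  [exact: measurable_lin_row|exact: design_subgaussian|].
exact: design_mean.
Qed.

Lemma design_lower_tail u : u != 0%R ->
  P [set w | (\sum_i lin u (tnth (X w) i) ^+ 2 <= n%:R * q u / 2)%R] <=
  (expR (- (n%:R / (256 * K ^+ 4))))%:E.
Proof.
move=> u0; have q0 := design_qform_gt0 u0.
have [[indX _] _ _ _ _] := designX.
(* With [t q = s] each observation contributes at most [- s + 16 K^4 s^2 = - 3 s / 4] to the
   exponent, and the threshold at half the mean gives back [s / 2]. This [s] is optimal, with net
   rate [s / 4 = 1 / (256 K^4)]. *)
pose s := ((64 * K ^+ 4)^-1)%R; pose t := (s / q u)%R.
have K4 : (0 < K ^+ 4)%R by rewrite exprn_gt0.
have s0 : (0 < s)%R by rewrite invr_gt0 mulr_gt0.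
have t0 : (0 <= t)%R by rewrite ltW// divr_gt0.
have := @chernoff_sum _ _ _ P _ _ _ (fun i w => tnth (X w) i)
  (fun _ x => - (t * lin u x ^+ 2))%R (- (3 / 4 * s))%R (- (t * (n%:R * q u / 2)))%R.
move=> /(_ measurable_row indX) h.
have -> : [set w | (\sum_i lin u (tnth (X w) i) ^+ 2 <= n%:R * q u / 2)%R] =
    [set w | (- (t * (n%:R * q u / 2)) <= \sum_i - (t * lin u (tnth (X w) i) ^+ 2))%R].
  apply/seteqP; split => w /=; rewrite sumrN lerN2 -mulr_sumr ler_pM2l// divr_gt0//.
have -> : (- (n%:R / (256 * K ^+ 4)) =
  n%:R * - (3 / 4 * s) - - (t * (n%:R * q u / 2)))%R.
  by rewrite /t /s; field; rewrite !gt_eqF.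
apply: h.
  move=> i; apply: measurableT_comp => //; apply: measurable_funM => //.
  by apply: measurable_funX; exact: measurable_lin.
move=> i.
have := integral_expRN_sqr_le (measurable_lin_row u i) (design_subgaussian i u0)
  (design_second_moment u i) t0.
move=> /le_trans; apply; rewrite lee_fin.
apply: le_trans (expR_ge1Dx _); rewrite le_eqVlt; apply/orP; left; apply/eqP.
by rewrite /t /s; field; rewrite !gt_eqF.
Qed.

Lemma design_upper_tail u : u != 0%R ->
  P [set w | (32 * K ^+ 2 * (n%:R * q u) <= \sum_i lin u (tnth (X w) i) ^+ 2)%R] <=
  (expR (- n%:R))%:E.
Proof.
move=> u0; have q0 := design_qform_gt0 u0.
have [[indX _] _ _ _ _] := designX.
(* The largest [t] that [integral_expR_sqr_le] allows: each factor has mean at most e, and the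
   threshold 32 = 2 * 16 leaves [expR (n - 2 n)]. *)
pose t := ((16 * (K ^+ 2 * q u))^-1)%R.
have K2 : (0 < K ^+ 2)%R by rewrite exprn_gt0.
have t0 : (0 < t)%R by rewrite invr_gt0 !mulr_gt0.
have tE : (16 * (K ^+ 2 * q u) * t = 1)%R.
  by rewrite /t; field; rewrite !gt_eqF.
have := @chernoff_sum _ _ _ P _ _ _ (fun i w => tnth (X w) i)
  (fun _ x => t * lin u x ^+ 2)%R 1%R (t * (32 * K ^+ 2 * (n%:R * q u)))%R.
move=> /(_ measurable_row indX) h.
have -> : [set w | (32 * K ^+ 2 * (n%:R * q u) <= \sum_i lin u (tnth (X w) i) ^+ 2)%R] =
    [set w | (t * (32 * K ^+ 2 * (n%:R * q u)) <=
      \sum_i t * lin u (tnth (X w) i) ^+ 2)%R].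
  by apply/seteqP; split => w /=; rewrite -mulr_sumr ler_pM2l.
have -> : (- n%:R = n%:R * 1 - t * (32 * K ^+ 2 * (n%:R * q u)))%R.
  by rewrite /t; field; rewrite !gt_eqF.
apply: h.
  move=> i; apply: measurable_funM => //.
  by apply: measurable_funX; exact: measurable_lin.
move=> i; rewrite -tE; apply: integral_expR_sqr_le; rewrite ?tE//; last 2 first.
- exact: design_subgaussian.
- exact: ltW.
exact: measurable_lin_row.
Qed.

End design.

(** * Maurey's empirical method *)

Section maurey.
Context {R : realType} (p : nat).
Implicit Types (A Sig : 'M[R]_p) (u v x : 'cV[R]_p).

Definition qform A v : R := dotv v (A *m v).

Definition signed_basis (g : 'I_p * bool) : 'cV[R]_p := (-1) ^+ g.2 *: delta_mx g.1 0.

Definition signed_sum (s : seq ('I_p * bool)) : 'cV[R]_p :=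
  \sum_(g <- s) signed_basis g.

Lemma signed_sum_nseq m k : signed_sum (nseq m (k, false)) = m%:R *: delta_mx k 0.
Proof. by rewrite /signed_sum big_nseq iter_addr_0 /signed_basis expr0 scale1r
  scaler_nat. Qed.

Lemma dotv_sym A x v : A^T = A -> dotv v (A *m x) = dotv x (A *m v).
Proof. by move=> Asym; rewrite dotv_mulmxr Asym dotvC. Qed.

Lemma qformD A x v : A^T = A -> qform A (x + v) =
  qform A x + 2 * dotv x (A *m v) + qform A v.
Proof.
move=> Asym; rewrite /qform mulmxDr dotvDl !dotvDr (dotv_sym x v Asym); ring.
Qed.

Lemma qform0 A : qform A 0 = 0.
Proof. by rewrite /qform mulmx0 dotv0r. Qed.

Lemma qformZ A a v : qform A (a *: v) = a ^+ 2 * qform A v.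
Proof. by rewrite /qform -scalemxAr dotvZl dotvZr; ring. Qed.

Lemma qform_subl A B v : qform (A - B) v = qform A v - qform B v.
Proof. by rewrite /qform mulmxBl dotvDr dotvNr. Qed.

Lemma qform_scalel a A v : qform (a *: A) v = a * qform A v.
Proof. by rewrite /qform -scalemxAl dotvZr. Qed.

Lemma qform_delta A k : qform A (delta_mx k 0) = A k k.
Proof. by rewrite /qform dotv_deltal -colE mxE. Qed.

Lemma qform_signed_basis A g : qform A (signed_basis g) = A g.1 g.1.
Proof. by rewrite /signed_basis qformZ sqrr_sign mul1r qform_delta. Qed.

(* The right-hand side of the conclusion is the expectation of
   [qform A (x + Z_1 + ... + Z_m)], where the [Z_i] are independent and equal
   to [sgn(v_k) e_k] with probability [|v_k|]. *)
Lemma maurey_expectation_ge0 A v : A^T = A -> l1norm v = 1 -> forall (m : nat) x,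
  (forall s, size s = m -> 0 <= qform A (x + signed_sum s)) ->
  0 <= qform A x + 2 * m%:R * dotv x (A *m v) + m%:R * (m%:R - 1) * qform A v +
       m%:R * \sum_k `|v k 0| * A k k.
Proof.
move=> Asym v1; elim=> [|m IH] x hs.
  have := hs [::] erefl; rewrite /signed_sum big_nil addr0; lra.
have [z zE] : exists z, forall k, z k = signed_basis (k, v k 0 < 0) by eexists.
have qz k : qform A (z k) = A k k by rewrite zE qform_signed_basis.
pose D := \sum_k `|v k 0| * A k k.
pose y := A *m (2 *: x + (2 * m%:R) *: v).
have [c cE] : exists c, c = qform A x + 2 * m%:R * dotv x (A *m v) +
    m%:R * (m%:R - 1) * qform A v + m%:R * D by eexists.
have step k : 0 <= c + dotv y (z k) + A k k.
  have := IH (x + z k); rewrite -/D qformD// dotvDl qz => h.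
  have yz : dotv y (z k) = 2 * dotv x (A *m z k) + 2 * m%:R * dotv (z k) (A *m v).
    rewrite dotvC /y mulmxDr -!scalemxAr dotvDr (dotvZr 2) (dotvZr (2 * m%:R)).
    by rewrite (dotv_sym x (z k) Asym).
  rewrite yz cE; apply: le_trans (h _) _; last by lra.
  move=> s ss; have := hs ((k, v k 0 < 0) :: s).
  by rewrite /signed_sum big_cons addrA -zE; apply; rewrite /= ss.
(* This averages over the first of the [m.+1] vectors, the induction hypothesis having averaged the
   other [m] around [x + z k]. The weights sum to 1, and the mean of [z k] is [v]. *)
have : 0 <= \sum_k `|v k 0| * (c + dotv y (z k) + A k k).
  by apply: sumr_ge0 => k _; rewrite mulr_ge0.
have -> : \sum_k `|v k 0| * (c + dotv y (z k) + A k k) = c + dotv y v + D.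
  under eq_bigr do rewrite !mulrDr.
  rewrite !big_split/= -mulr_suml -/(l1norm v) v1 mul1r; congr (_ + _ + _).
  apply: eq_bigr => k _.
  rewrite zE /signed_basis dotvZr dotvC dotv_deltal mulrA (mulrC `|_|).
  by rewrite /= mulr_sign_norm mulrC.
have yv : dotv y v = 2 * dotv x (A *m v) + 2 * m%:R * qform A v.
  rewrite dotvC /y mulmxDr -!scalemxAr dotvDr !dotvZr.
  by rewrite (dotv_sym x v Asym).
rewrite yv cE -/D -natr1 => h; apply: le_trans h _; rewrite le_eqVlt; apply/orP;
  left; apply/eqP; ring.
Qed.

Lemma l1norm_ge0 v : 0 <= l1norm v.
Proof. exact: sumr_ge0. Qed.

Lemma l1normZ a v : l1norm (a *: v) = `|a| * l1norm v.
Proof. by rewrite /l1norm mulr_sumr; apply: eq_bigr => k _; rewrite mxE normrM. Qed.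

Lemma l1norm_eq0 v : l1norm v = 0 -> v = 0.
Proof.
move=> /eqP; rewrite psumr_eq0// => /allP h; apply/matrixP => i k; rewrite ord1 mxE.
by have := h i (mem_index_enum _); rewrite normr_eq0 => /eqP.
Qed.

(** The expectation at [x = 0] for [|v|_1 = 1], divided by [m]: its diagonal term is an average of
    the [A k k], hence at most [D]. Homogeneity brings in [l1norm v ^+ 2]. *)
Lemma maurey_qform_ge A (m : nat) (D : R) v : A^T = A -> (0 < m)%N ->
  (forall s, size s = m -> 0 <= qform A (signed_sum s)) ->
  (forall k, A k k <= D) ->
  0 <= (m%:R - 1) * qform A v + D * l1norm v ^+ 2.
Proof.
move=> Asym m0 net AD.
have [v0|vn0] := eqVneq (l1norm v) 0.
  by rewrite v0 (l1norm_eq0 v0) qform0 expr0n/= !mulr0 addr0.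
have vp : 0 < l1norm v by rewrite lt_neqAle eq_sym vn0 l1norm_ge0.
set r := l1norm v in vp *; pose v1 := r^-1 *: v.
have v11 : l1norm v1 = 1 by rewrite l1normZ ger0_norm ?invr_ge0 ?(ltW vp)// mulVf.
have := @maurey_expectation_ge0 A v1 Asym v11 m 0.
rewrite qform0 dotvC dotv0r mulr0 !add0r => h.
have {}h : 0 <= m%:R * ((m%:R - 1) * qform A v1 + \sum_k `|v1 k 0| * A k k).
  by rewrite mulrDr mulrA; apply: h => s ss; rewrite add0r; exact: net.
have mR : 0 < m%:R :> R by rewrite ltr0n.
rewrite pmulr_rge0// in h.
have hD : \sum_k `|v1 k 0| * A k k <= D.
  apply: (@le_trans _ _ (\sum_k `|v1 k 0| * D)).
    by apply: ler_sum => k _; rewrite ler_wpM2l.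
  by rewrite -mulr_suml -/(l1norm v1) v11 mul1r.
have -> : qform A v = r ^+ 2 * qform A v1.
  by rewrite -qformZ /v1 scalerA divff ?scale1r// gt_eqF.
have -> : (m%:R - 1) * (r ^+ 2 * qform A v1) + D * r ^+ 2 =
  r ^+ 2 * ((m%:R - 1) * qform A v1 + D) by ring.
by rewrite mulr_ge0 ?sqr_ge0//; lra.
Qed.

(** Maurey's step for [A - Sig / 2] and [C Sig - A]. Both diagonals are at most [C L]: as [m] copies
    of a basis vector form one of the sums, the hypotheses also give [0 <= A k k <= C * Sig k k]. *)
Lemma qform_net_bounds A Sig (m : nat) (C L : R) : A^T = A -> Sig^T = Sig ->
  (1 < m)%N -> 0 <= C -> (forall v, 0 <= qform Sig v <= L * dotv v v) ->
  (forall s, size s = m -> qform Sig (signed_sum s) / 2 <= qform A (signed_sum s)) ->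
  (forall s, size s = m -> qform A (signed_sum s) <= C * qform Sig (signed_sum s)) ->
  forall v, qform Sig v / 2 - C * L / (m%:R - 1) * l1norm v ^+ 2 <= qform A v /\
            qform A v <= C * qform Sig v + C * L / (m%:R - 1) * l1norm v ^+ 2.
Proof.
move=> Asym Ssym m1 C0 SigL low up v.
have m0 : (0 < m)%N by rewrite ltnW.
have mR : 0 < m%:R :> R by rewrite ltr0n.
have m1R : 0 < m%:R - 1 :> R by rewrite subr_gt0 ltr1n.
have SigkL k : 0 <= Sig k k <= L.
  have := SigL (delta_mx k 0); rewrite qform_delta.
  by rewrite dotv_deltal mxE !eqxx mulr1.
have Akk k : A k k <= C * L.
  have := up (nseq m (k, false)) (size_nseq _ _).
  rewrite signed_sum_nseq !qformZ !qform_delta mulrCA ler_pM2l ?exprn_gt0// =>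
    /le_trans; apply.
  by rewrite ler_wpM2l//; case/andP: (SigkL k).
have key (Q : 'M[R]_p) : Q^T = Q -> (forall s, size s = m -> 0 <=
  qform Q (signed_sum s)) ->
    (forall k, Q k k <= C * L) -> 0 <= qform Q v + C * L / (m%:R - 1) * l1norm v ^+ 2.
  move=> Qsym Qnet Qk; have h := maurey_qform_ge v Qsym m0 Qnet Qk.
  rewrite -(pmulr_rge0 _ m1R); apply: le_trans h _; rewrite le_eqVlt.
  by apply/orP; left; apply/eqP; field; rewrite gt_eqF.
split.
  have := key (A - 2^-1 *: Sig); rewrite linearB/= linearZ/= Asym Ssym => /(_ erefl).
  rewrite qform_subl qform_scalel => h.
  suff : 0 <= qform A v - 2^-1 * qform Sig v + C * L / (m%:R - 1) * l1norm v ^+ 2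
    by lra.
  apply: h => [s ss|k]; first by rewrite qform_subl qform_scalel; have := low s ss; lra.
  by rewrite !mxE; have := Akk k; have := SigkL k => /andP[]; lra.
have := key (C *: Sig - A); rewrite linearB/= linearZ/= Asym Ssym => /(_ erefl).
rewrite qform_subl qform_scalel => h.
suff : 0 <= C * qform Sig v - qform A v + C * L / (m%:R - 1) * l1norm v ^+ 2 by lra.
apply: h => [s ss|k]; first by rewrite qform_subl qform_scalel; have := up s ss; lra.
have Ak0 : 0 <= A k k.
  have := low (nseq m (k, false)) (size_nseq _ _).
  rewrite signed_sum_nseq !qformZ !qform_delta -mulrA ler_pM2l ?exprn_gt0//.
  by apply: le_trans; have /andP[] := SigkL k; lra.
rewrite !mxE; have /andP[_ /(ler_wpM2l C0)] := SigkL k; lra.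
Qed.

End maurey.

(** * Optimality conditions and deterministic error bounds *)

Section norms.
Context {R : realType} (p : nat).
Implicit Types (u v b : 'cV[R]_p) (S : {set 'I_p}).

Lemma l1normD u v : l1norm (u + v) <= l1norm u + l1norm v.
Proof. by rewrite /l1norm -big_split/=; apply: ler_sum => k _;
  rewrite mxE ler_normD. Qed.

Lemma l1norm_setC S v : l1norm v = \sum_(k in S) `|v k 0| + \sum_(k in ~: S) `|v k 0|.
Proof.
by rewrite /l1norm (bigID (mem S))/=; congr (_ + _); apply: eq_bigl => k; rewrite inE.
Qed.

Lemma sqr_sum_norm_le S v : (\sum_(k in S) `|v k 0|) ^+ 2 <= #|S|%:R * dotv v v.
Proof.
pose f : 'cV[R]_p := \col_k (k \in S)%:R; pose g : 'cV[R]_p := \col_k `|v k 0|.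
have -> : \sum_(k in S) `|v k 0| = dotv f g.
  rewrite big_mkcond; apply: eq_bigr => k _; rewrite !mxE.
  by case: ifP; rewrite ?mul1r ?mul0r.
have -> : #|S|%:R = dotv f f.
  rewrite -sum1_card natr_sum big_mkcond; apply: eq_bigr => k _; rewrite !mxE.
  by case: ifP; rewrite ?mul1r ?mul0r.
have -> : dotv v v = dotv g g.
  by apply: eq_bigr => k _; rewrite !mxE -expr2 -normrM -expr2 ger0_norm ?sqr_ge0.
exact: cauchy_schwarz_dotv.
Qed.

Lemma l1norm_supp_le b u : l1norm b - l1norm (b + u) <=
  \sum_(k in supp b) `|u k 0| - \sum_(k in ~: supp b) `|u k 0|.
Proof.
rewrite (l1norm_setC (supp b) b) (l1norm_setC (supp b) (b + u)).
have -> : \sum_(k in ~: supp b) `|b k 0| = 0.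
  by apply: big1 => k; rewrite !inE negbK => /eqP ->; rewrite normr0.
have -> : \sum_(k in ~: supp b) `|(b + u) k 0| = \sum_(k in ~: supp b) `|u k 0|.
  by apply: eq_bigr => k; rewrite !inE negbK mxE => /eqP ->; rewrite add0r.
suff : \sum_(k in supp b) `|b k 0| <=
    \sum_(k in supp b) `|(b + u) k 0| + \sum_(k in supp b) `|u k 0| by lra.
rewrite -big_split/=; apply: ler_sum => k _; rewrite mxE.
by have := ler_normB (b k 0 + u k 0) (u k 0); rewrite addrK.
Qed.

Lemma dotv_le_l1norm u v (c : R) : (forall k, `|v k 0| <= c) ->
  dotv u v <= c * l1norm u.
Proof.
move=> vc; rewrite /dotv /l1norm mulr_sumr; apply: ler_sum => k _.
by rewrite (le_trans (ler_norm _))// normrM mulrC ler_wpM2r.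
Qed.

End norms.

Section gram.
Context {R : realType} (n p : nat) (X : 'M[R]_(n, p)).
Implicit Types (u v b d : 'cV[R]_p) (y : 'cV[R]_n).

Definition gram : 'M[R]_p := n%:R^-1 *: (X^T *m X).

Lemma gram_sym : gram^T = gram.
Proof. by rewrite /gram linearZ/= trmx_mul trmxK. Qed.

Lemma dotv_gram u v : dotv u (gram *m v) = n%:R^-1 * dotv (X *m u) (X *m v).
Proof. by rewrite /gram -scalemxAl dotvZr -mulmxA dotv_mulmxr trmxK. Qed.

Lemma qform_gram v : qform gram v = n%:R^-1 * l2norm (X *m v) ^+ 2.
Proof. by rewrite /qform dotv_gram sqr_l2norm. Qed.

Lemma qform_gram_ge0 v : 0 <= qform gram v.
Proof. by rewrite qform_gram mulr_ge0 ?sqr_ge0// invr_ge0. Qed.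

Lemma qform_gramD_le u v : qform gram (u + v) <= 2 * qform gram u + 2 * qform gram v.
Proof.
have := qform_gram_ge0 (u - v); rewrite !qformD ?gram_sym//.
have -> : dotv u (gram *m - v) = - dotv u (gram *m v) by rewrite mulmxN dotvNr.
have -> : qform gram (- v) = qform gram v.
  by rewrite -scaleN1r qformZ sqrrN expr1n mul1r.
lra.
Qed.

Lemma gram_cauchy_schwarz u v :
  dotv u (gram *m v) ^+ 2 <= qform gram u * qform gram v.
Proof.
rewrite !qform_gram !sqr_l2norm dotv_gram exprMn [leRHS]mulrACA -expr2.
by apply: ler_wpM2l; [exact: sqr_ge0|exact: cauchy_schwarz_dotv].
Qed.

Lemma half_qform_gram v : (2 * n%:R)^-1 * l2norm (X *m v) ^+ 2 = 2^-1 * qform gram v.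
Proof. by rewrite qform_gram invfM mulrA. Qed.

Lemma loss_add y b d : (2 * n%:R)^-1 * l2norm (y - X *m (b + d)) ^+ 2 =
  (2 * n%:R)^-1 * l2norm (y - X *m b) ^+ 2 - n%:R^-1 * dotv (y - X *m b) (X *m d) +
  2^-1 * qform gram d.
Proof.
rewrite qform_gram mulmxDr opprD addrA; move: (y - X *m b) (X *m d) => r e.
rewrite !sqr_l2norm dotvDl !dotvDr !dotvNl !dotvNr (dotvC e r) invfM.
by move: (n%:R^-1) => c; field.
Qed.

End gram.

(** * Scalar inequalities behind the error bounds *)

Section arithmetic.
Context {R : realType} (lambda s a r rho : R).
Hypotheses (lambda_gt0 : 0 < lambda) (s_ge0 : 0 <= s) (a_gt0 : 0 < a).
Hypotheses (r_ge0 : 0 <= r) (rho_ge0 : 0 <= rho) (rhoE : a * rho = lambda * s).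
Hypothesis rs_small : r * s <= a / 144.

(** [x] and [z] are the l1 norms of the error on and off the support of [beta], [N] its squared l2
    norm, [Q] its prediction error. The loss [16 r x^2 <= 16 r s N <= a N / 9] is absorbed, leaving
    [a N / 2 <= 3 lambda x]; combine with [x^2 <= s N]. *)
Lemma cone_l1_bound (x z N Q : R) : 0 <= x -> 0 <= z -> 0 <= N -> z <= 3 * x ->
  Q + lambda * z <= 3 * (lambda * x) -> x ^+ 2 <= s * N ->
  a * N - r * (x + z) ^+ 2 <= Q -> x <= 6 * rho.
Proof.
move=> x0 z0 N0 zx basic cs low.
have l1sq : (x + z) ^+ 2 <= 16 * x ^+ 2.
  have -> : 16 * x ^+ 2 = (4 * x) ^+ 2 by ring.
  by rewrite lerXn2r ?nnegrE ?addr_ge0 ?mulr_ge0//; lra.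
have e1 : r * (x + z) ^+ 2 <= r * (16 * x ^+ 2) by rewrite ler_wpM2l.
have e2 : r * x ^+ 2 <= r * (s * N) by rewrite ler_wpM2l.
have e3 : r * (s * N) <= a / 144 * N by rewrite mulrA ler_wpM2r.
have e4 : a / 2 * N <= 3 * (lambda * x).
  have := mulr_ge0 (ltW lambda_gt0) z0; have := mulr_ge0 (ltW a_gt0) N0; lra.
have e5 : s * (a / 2 * N) <= s * (3 * (lambda * x)) by rewrite ler_wpM2l.
have e6 : a / 2 * x ^+ 2 <= a / 2 * (s * N) by rewrite ler_wpM2l// divr_ge0// ltW.
have e7 : a / 2 * x ^+ 2 <= 3 * (a * rho) * x by rewrite rhoE; lra.
have [->|xn0] := eqVneq x 0; first by rewrite mulr_ge0.
have xp : 0 < x by rewrite lt_neqAle eq_sym xn0.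
have axp : 0 < a / 2 * x by rewrite mulr_gt0// divr_gt0.
by rewrite -(ler_pM2l axp); lra.
Qed.

(** The prediction error [G] of the first Lasso adds a constant to the cone condition, which becomes
    [z <= x + 18 rho]. After absorption [17/18 x^2 <= 76.5 rho^2 + 4 rho x] remains, which forces
    [x <= 12 rho]; then 42 = 2 * 12 + 18. *)
Lemma boot_l1_bound (x z N Q G : R) : 0 <= x -> 0 <= z -> 0 <= Q ->
  G <= 18 * lambda * rho ->
  Q + 4 * (lambda * z) <= 4 * G + 4 * (lambda * x) -> x ^+ 2 <= s * N ->
  a * N - r * (x + z) ^+ 2 <= Q -> x + z <= 42 * rho.
Proof.
move=> x0 z0 Q0 G18 basic cs low.
have zx : z <= x + 18 * rho by rewrite -(ler_pM2l lambda_gt0); lra.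
have l1sq : (x + z) ^+ 2 <= 8 * x ^+ 2 + 648 * rho ^+ 2.
  apply: (@le_trans _ _ ((2 * x + 18 * rho) ^+ 2)).
    by rewrite lerXn2r ?nnegrE ?addr_ge0 ?mulr_ge0//; lra.
  by have := sqr_ge0 (2 * x - 18 * rho); lra.
have e1 : r * (x + z) ^+ 2 <= r * (8 * x ^+ 2 + 648 * rho ^+ 2) by rewrite ler_wpM2l.
have lz := mulr_ge0 (ltW lambda_gt0) z0.
have e2 : s * (a * N) <= s * (72 * lambda * rho + 4 * (lambda * x) +
    r * (8 * x ^+ 2 + 648 * rho ^+ 2)) by rewrite ler_wpM2l//; lra.
have e3 : r * s * (8 * x ^+ 2 + 648 * rho ^+ 2) <=
  a / 144 * (8 * x ^+ 2 + 648 * rho ^+ 2).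
  by apply: ler_wpM2r rs_small; have := sqr_ge0 x; have := sqr_ge0 rho; lra.
have e4 : a * x ^+ 2 <= a * (s * N) by rewrite ler_wpM2l// ltW.
have e5 : a * x ^+ 2 <= a * (72 * rho ^+ 2 + 4 * rho * x + (8 * x ^+ 2 + 648 *
  rho ^+ 2) / 144).
  have -> : a * (72 * rho ^+ 2 + 4 * rho * x + (8 * x ^+ 2 + 648 * rho ^+ 2) / 144) =
    72 * (a * rho) * rho + 4 * (a * rho) * x + a / 144 * (8 * x ^+ 2 + 648 * rho
      ^+ 2) by field.
  by rewrite rhoE; lra.
rewrite ler_pM2l// in e5.
suff : x <= 12 * rho by lra.
nra.
Qed.

(** The bound is self-referential: the support size [N] returns on the right through the l1 term of
    the upper bound. Its coefficient [72 r s / a] is at most 1/2 exactly when [r s <= a / 144],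
    which fixes that constant. *)
Lemma support_size_bound (U N g G : R) : 0 <= U -> 0 <= N ->
  N * (lambda ^+ 2 / 4) <= g -> g <= (U + r * N) * G -> G <= 18 * lambda * rho ->
  N <= 144 * U * s / a.
Proof.
move=> U0 N0 low gG G18.
have UN0 : 0 <= U + r * N by rewrite addr_ge0// mulr_ge0.
have e2 : (U + r * N) * G <= (U + r * N) * (18 * lambda * rho) by rewrite ler_wpM2l.
have l2 : 0 < lambda ^+ 2 / 4 by rewrite divr_gt0// exprn_gt0.
have rho' : rho = lambda * s / a by rewrite -rhoE; field; rewrite gt_eqF.
have e4 : N <= (U + r * N) * (72 * s / a).
  rewrite -(ler_pM2r l2); apply: le_trans (le_trans low (le_trans gG e2)) _.
  by rewrite le_eqVlt rho'; apply/orP; left; apply/eqP; field; rewrite gt_eqF.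
have e5 : r * s * (72 / a * N) <= a / 144 * (72 / a * N).
  by rewrite ler_wpM2r// mulr_ge0// divr_ge0// ltW.
have e6 : a / 144 * (72 / a * N) = N / 2 by field; rewrite gt_eqF.
have e7 : (U + r * N) * (72 * s / a) = 72 * (U * s / a) + r * s * (72 / a * N).
  by field; rewrite gt_eqF.
have -> : 144 * U * s / a = 144 * (U * s / a) by field; rewrite gt_eqF.
lra.
Qed.

End arithmetic.

(** * Error bounds for the Lasso and the bootstrapped Lasso *)

Section lasso.
Context {R : realType} (n p : nat) (X : 'M[R]_(n, p)).
Context (y eps : 'cV[R]_n) (beta bhat bstar : 'cV[R]_p) (lambda : R).
Hypotheses (yE : y = X *m beta + eps) (lambda_gt0 : 0 < lambda).
Hypothesis noise : forall k, `|n%:R^-1 * dotv (col k X) eps| <= lambda / 2.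
Hypothesis bhatP : is_lasso X y lambda bhat.
Hypothesis bstarP : is_lasso X (X *m bhat) lambda bstar.

Let A := gram X.
Let S := supp beta.
Let s : R := #|S|%:R.
Let u := bhat - beta.
Let h := bstar - beta.
Let uS := \sum_(k in S) `|u k 0|.
Let uSc := \sum_(k in ~: S) `|u k 0|.
Let hS := \sum_(k in S) `|h k 0|.
Let hSc := \sum_(k in ~: S) `|h k 0|.

Let uS_ge0 : 0 <= uS. Proof. exact: sumr_ge0. Qed.
Let uSc_ge0 : 0 <= uSc. Proof. exact: sumr_ge0. Qed.
Let hS_ge0 : 0 <= hS. Proof. exact: sumr_ge0. Qed.
Let hSc_ge0 : 0 <= hSc. Proof. exact: sumr_ge0. Qed.

Lemma noise_dotv v : n%:R^-1 * dotv eps (X *m v) <= lambda / 2 * l1norm v.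
Proof.
have -> : n%:R^-1 * dotv eps (X *m v) = dotv v (n%:R^-1 *: (X^T *m eps)).
  by rewrite dotvZr dotv_mulmxr dotvC.
apply: dotv_le_l1norm => k; rewrite mxE.
have -> : (X^T *m eps) k 0 = dotv (col k X) eps.
  by rewrite mxE; apply: eq_bigr => i _; rewrite !mxE.
exact: noise.
Qed.

Lemma lasso_basic_ineq : qform A u + lambda * uSc <= 3 * (lambda * uS).
Proof.
have [_ /(_ beta Logic.I)] := bhatP; rewrite /lasso_obj.
have -> : bhat = beta + u by rewrite /u addrC subrK.
rewrite loss_add -/A.
have -> : y - X *m beta = eps by rewrite yE addrAC subrr add0r.
have := noise_dotv u; have := l1norm_supp_le beta u.
rewrite -/S -/uS -/uSc (l1norm_setC S u) -/uS -/uSc => h1 h2 h3.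
have : lambda * (l1norm beta - l1norm (beta + u)) <= lambda * (uS - uSc).
  by rewrite ler_wpM2l// ltW.
lra.
Qed.

Lemma boot_lasso_basic_ineq :
  qform A h + 4 * (lambda * hSc) <= 4 * qform A u + 4 * (lambda * hS).
Proof.
have [_ /(_ beta Logic.I)] := bstarP; rewrite /lasso_obj.
have e b : X *m bhat - X *m b = X *m (bhat - b) by rewrite mulmxBr.
rewrite !e !half_qform_gram -/A -/u => h1.
have qd := qform_gramD_le X (bstar - bhat) u; rewrite -/A in qd.
have hE : bstar - bhat + u = h by rewrite /u /h addrA subrK.
have qN : qform A (bstar - bhat) = qform A (bhat - bstar).
  by rewrite -opprB -scaleN1r qformZ sqrrN expr1n mul1r.
rewrite hE qN in qd.
have := l1norm_supp_le beta h.
have -> : beta + h = bstar by rewrite /h addrC subrK.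
rewrite -/S -/hS -/hSc => h2.
have : lambda * (l1norm beta - l1norm bstar) <= lambda * (hS - hSc).
  by rewrite ler_wpM2l// ltW.
lra.
Qed.

Lemma lasso_sparsity0 : #|S| = 0%N -> bhat = beta /\ bstar = beta.
Proof.
move=> S0.
have z (v : 'cV[R]_p) : \sum_(k in S) `|v k 0| = 0 :> R.
  by rewrite (cards0_eq S0) big_set0.
have E (v : 'cV[R]_p) : \sum_(k in ~: S) `|v k 0| = 0 :> R -> v = 0.
  by move=> v0; apply: l1norm_eq0; rewrite (l1norm_setC S) z v0 addr0.
have u0 : u = 0.
  apply: E; apply/eqP; rewrite eq_le uSc_ge0 andbT -/uSc -(pmulr_rle0 _ lambda_gt0).
  have := lasso_basic_ineq; have := qform_gram_ge0 X u.
  by rewrite /uS z -/A; lra.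
have h0 : h = 0.
  apply: E; apply/eqP; rewrite eq_le hSc_ge0 andbT -/hSc -(pmulr_rle0 _ lambda_gt0).
  have := boot_lasso_basic_ineq; have := qform_gram_ge0 X h.
  by rewrite /hS z u0 qform0 -/A; lra.
by split; apply/eqP; rewrite -subr_eq0; apply/eqP.
Qed.

Context (a r U : R).
Hypotheses (a_gt0 : 0 < a) (r_ge0 : 0 <= r) (U_ge0 : 0 <= U).
Hypothesis lower : forall v, a * dotv v v - r * l1norm v ^+ 2 <= qform A v.
Hypothesis upper : forall v, qform A v <= U * dotv v v + r * l1norm v ^+ 2.
Hypothesis rs_small : r * s <= a / 144.

Let rho := lambda * s / a.

Let s_ge0 : 0 <= s. Proof. exact: ler0n. Qed.

Let rho_ge0 : 0 <= rho.
Proof. by rewrite /rho divr_ge0// ?mulr_ge0// ltW. Qed.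

Let rhoE : a * rho = lambda * s.
Proof. by rewrite /rho; field; rewrite gt_eqF. Qed.

Let uSc_le : uSc <= 3 * uS.
Proof.
rewrite -(ler_pM2l lambda_gt0) mulrCA.
by have := qform_gram_ge0 X u; have := lasso_basic_ineq; rewrite -/A; lra.
Qed.

Let uS_le : uS <= 6 * rho.
Proof.
apply: (cone_l1_bound lambda_gt0 s_ge0 a_gt0 r_ge0 rho_ge0 rhoE rs_small
  (z := uSc) (N := dotv u u) (Q := qform A u)) => //.
- exact: dotvv_ge0.
- exact: lasso_basic_ineq.
- exact: sqr_sum_norm_le.
- by have := lower u; rewrite (l1norm_setC S u).
Qed.

Lemma lasso_l1_error : l1norm u <= 24 * rho.
Proof.
by rewrite (l1norm_setC S) -/uS -/uSc; have := uS_le; have := uSc_le; lra.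
Qed.

Lemma lasso_prediction_error : qform A u <= 18 * lambda * rho.
Proof.
have basic := lasso_basic_ineq.
have : lambda * uS <= lambda * (6 * rho) by apply: ler_wpM2l uS_le; exact: ltW.
have := mulr_ge0 (ltW lambda_gt0) uSc_ge0; lra.
Qed.

Lemma boot_lasso_l1_error : l1norm h <= 42 * rho.
Proof.
rewrite (l1norm_setC S h) -/hS -/hSc.
apply: (boot_l1_bound lambda_gt0 s_ge0 a_gt0 r_ge0 rho_ge0 rhoE rs_small
  (N := dotv h h) (Q := qform A h) (G := qform A u)) => //.
- exact: qform_gram_ge0.
- exact: lasso_prediction_error.
- exact: boot_lasso_basic_ineq.
- exact: sqr_sum_norm_le.
- by have := lower h; rewrite (l1norm_setC S h).
Qed.

(** Shrinking coordinate [k] by the factor [1 - t] lowers the l1 norm by [t |bhat_k|], so at a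
    minimiser an active coordinate must pay for its penalty by a correlation of size [lambda] with
    the residual. *)
Let bhat_kkt k : bhat k 0 != 0 -> lambda <= `|n%:R^-1 * dotv (col k X) (y - X *m bhat)|.
Proof.
move=> bk; set c := n%:R^-1 * _.
suff : 0 <= bhat k 0 * c - lambda * `|bhat k 0|.
  rewrite subr_ge0 => /le_trans/(_ (ler_norm _)); rewrite normrM mulrC.
  by rewrite ler_pM2l// normr_gt0.
apply: (@ge0_slope _ _ (2^-1 * qform A (bhat k 0 *: delta_mx k 0))) => t /andP[t0 t1].
have [_ /(_ (bhat + - (t * bhat k 0) *: delta_mx k 0) Logic.I)] := bhatP.
rewrite /lasso_obj loss_add -/A qformZ.
have -> : n%:R^-1 * dotv (y - X *m bhat) (X *m (- (t * bhat k 0) *: delta_mx k 0)) =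
    - (t * bhat k 0) * c.
  by rewrite -scalemxAr dotvZr mulmx_delta dotvC /c; ring.
have -> : l1norm (bhat + - (t * bhat k 0) *: delta_mx k 0) =
  l1norm bhat - t * `|bhat k 0|.
  rewrite /l1norm (bigD1 k)//= [in RHS](bigD1 k)//= !mxE !eqxx mulr1 addrAC;
    congr (_ + _).
    have -> : bhat k 0 - t * bhat k 0 = (1 - t) * bhat k 0 by ring.
    by rewrite normrM ger0_norm ?subr_ge0//; ring.
  by apply: eq_bigr => l lk; rewrite !mxE (negbTE lk) mulr0 addr0.
rewrite qformZ; lra.
Qed.

(** On the support of [bhat], the optimality conditions less the noise leave [|c_k| >= lambda / 2],
    where [c = A u]. For the restriction [g] of [c] to that support, [|g|_2^2 = <g, A u>], and
    Cauchy-Schwarz for the form of [A] bounds it by [U + r N] times the prediction error. *)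
Lemma lasso_support_size : #|supp bhat|%:R <= 144 * U * s / a.
Proof.
set Sh := supp bhat; set N : R := #|Sh|%:R.
pose c : 'cV[R]_p := A *m u.
pose g : 'cV[R]_p := \col_k (if k \in Sh then c k 0 else 0).
have N0 : 0 <= N by exact: ler0n.
have ck k : k \in Sh -> lambda / 2 <= `|c k 0|.
  rewrite inE => /bhat_kkt; have := noise k.
  have -> : y - X *m bhat = eps - X *m u by rewrite yE mulmxBr opprB addrAC addrC.
  rewrite dotvDr dotvNr mulrDr mulrN.
  have -> : n%:R^-1 * dotv (col k X) (X *m u) = c k 0.
    by rewrite /c -(dotv_deltal k) -/A dotv_gram mulmx_delta.
  by move=> h1 h2; have := ler_normB (n%:R^-1 * dotv (col k X) eps) (c k 0); lra.
have gc : dotv g c = dotv g g.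
  by apply: eq_bigr => k _; rewrite !mxE; case: ifP => _; rewrite ?mul0r.
have gE : dotv g g = \sum_(k in Sh) c k 0 ^+ 2.
  rewrite [RHS]big_mkcond; apply: eq_bigr => k _; rewrite !mxE.
  by case: ifP => _; rewrite ?mul0r ?expr2.
have glow : N * (lambda ^+ 2 / 4) <= dotv g g.
  rewrite gE /N -sum1_card natr_sum mulr_suml; apply: ler_sum => k kS.
  rewrite mul1r -(real_normK (num_real (c k 0))).
  have -> : lambda ^+ 2 / 4 = (lambda / 2) ^+ 2 by field.
  by rewrite lerXn2r ?nnegrE ?ck// divr_ge0// ltW.
have gl1 : l1norm g ^+ 2 <= N * dotv g g.
  have -> : l1norm g = \sum_(k in Sh) `|g k 0|.
    rewrite (l1norm_setC Sh) [X in _ + X]big1 ?addr0// => k.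
    by rewrite !inE mxE inE => /negbTE ->; rewrite normr0.
  exact: sqr_sum_norm_le.
have gg0 := dotvv_ge0 g.
have cs := gram_cauchy_schwarz X g u; rewrite -/A -/c gc in cs.
have G := lasso_prediction_error; have G0 := qform_gram_ge0 X u; rewrite -/A in G0.
have up : qform A g <= (U + r * N) * dotv g g.
  by apply: le_trans (upper g) _; have := ler_wpM2l r_ge0 gl1; lra.
have UN0 : 0 <= U + r * N by rewrite addr_ge0// mulr_ge0.
apply: (support_size_bound lambda_gt0 a_gt0 r_ge0 rhoE rs_small
  (g := dotv g g) (G := qform A u)) => //.
have [->|gn0] := eqVneq (dotv g g) 0; first by rewrite mulr_ge0.
have gp : 0 < dotv g g by rewrite lt_neqAle eq_sym gn0.
rewrite -(ler_pM2l gp) -expr2; apply: le_trans cs _.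
by rewrite mulrCA mulrA ler_wpM2r.
Qed.

End lasso.

(** * The correction score *)

Section score.
Context {R : realType} (n p : nat) (X : 'M[R]_(n, p)).
Context (Sh : {set 'I_p}) (j : 'I_p) (lambdaj : R) (kappa : 'cV[R]_p).
Hypotheses (n_gt0 : (0 < n)%N) (lambdaj_gt0 : 0 < lambdaj).
Hypothesis kappaP : is_kappa X Sh j lambdaj kappa.

Let A := gram X.
Let pen (v : 'cV[R]_p) : R := \sum_(k | (k \notin Sh) && (k != j)) `|v k 0|.
Let c (k : 'I_p) : R := (A *m kappa) k 0.

Let pen_ge0 v : 0 <= pen v. Proof. exact: sumr_ge0. Qed.

Let kappa_j : kappa j 0 = 1. Proof. by case: kappaP. Qed.

Let kappa_min (v : 'cV[R]_p) : v j 0 = 1 ->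
  2^-1 * qform A kappa + lambdaj * pen kappa <= 2^-1 * qform A v + lambdaj * pen v.
Proof. by move=> vj; have [_ /(_ v vj)] := kappaP;
  rewrite /kappa_obj !half_qform_gram. Qed.

(** Directions with [d j 0 = 0] respect the constraint [kappa_j = 1]. The number [e] bounds the
    slope of the penalty, so its lack of smoothness is left to the choice of [d]. *)
Lemma kappa_direction (d : 'cV[R]_p) (e : R) : d j 0 = 0 ->
  (forall t, 0 < t <= 1 -> pen (kappa + t *: d) <= pen kappa + t * e) ->
  0 <= dotv d (A *m kappa) + lambdaj * e.
Proof.
move=> dj pd; apply: (@ge0_slope _ _ (2^-1 * qform A d)) => t t01.
have /kappa_min : (kappa + t *: d) j 0 = 1 by rewrite !mxE dj mulr0 addr0.
rewrite qformD ?gram_sym// qformZ -scalemxAr dotvZr (dotv_sym d kappa (gram_sym X)).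
have : lambdaj * pen (kappa + t *: d) <= lambdaj * (pen kappa + t * e).
  by rewrite ler_wpM2l ?(ltW lambdaj_gt0)// pd.
rewrite -/A; lra.
Qed.

(** A coordinate direction of either sign changes the penalty at rate at most 1, and at rate 0 on
    [Sh], where the conclusion is exact orthogonality. *)
Lemma kappa_kkt k : k != j -> `|c k| <= lambdaj * (k \notin Sh)%:R.
Proof.
move=> kj.
have key (sg : R) : `|sg| = 1 -> 0 <= sg * c k + lambdaj * (k \notin Sh)%:R.
  move=> sg1; have -> : sg * c k = dotv (sg *: delta_mx k 0) (A *m kappa).
    by rewrite dotvZl dotv_deltal.
  apply: kappa_direction => [|t /andP[t0 _]].
    by rewrite !mxE eq_sym (negbTE kj) mulr0.
  have -> : t * (k \notin Sh)%:R =
    \sum_(l | (l \notin Sh) && (l != j)) (if l == k then t else 0).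
    rewrite -big_mkcondr/=; have [kS|kS] := boolP (k \in Sh).
      rewrite mulr0 big1// => l /andP[/andP[lS _] /eqP lk]; by rewrite lk kS in lS.
    rewrite (big_pred1 k) ?mulr1// => l; rewrite /=.
    by case: (eqVneq l k) => [->|]; rewrite ?kS ?kj ?andbF.
  rewrite /pen -big_split/=; apply: ler_sum => l _; rewrite !mxE eqxx andbT.
  case: (l == k); last by rewrite !mulr0 !addr0.
  by rewrite mulr1 (le_trans (ler_normD _ _))// lerD2l normrM sg1 mulr1 ger0_norm// ltW.
have k1 := key 1 (normr1 _); have k2 : 0 <= - 1 * c k + lambdaj * (k \notin Sh)%:R.
  by apply: key; rewrite normrN normr1.
rewrite ler_norml; apply/andP; split; lra.
Qed.

Lemma kappa_diag_ge : qform A kappa <= c j.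
Proof.
(* Moving from [kappa] towards [delta_mx j 0] shrinks the penalty. *)
have := @kappa_direction (delta_mx j 0 - kappa) 0.
rewrite mulr0 addr0 dotvDl dotvNl dotv_deltal subr_ge0; apply.
  by rewrite !mxE !eqxx kappa_j subrr.
move=> t /andP[t0 t1]; rewrite mulr0 addr0; apply: ler_sum => k /andP[_ kj].
rewrite !mxE eqxx andbT (negbTE kj) sub0r mulrN.
have -> : kappa k 0 - t * kappa k 0 = (1 - t) * kappa k 0 by ring.
by rewrite normrM ger0_norm ?subr_ge0// ler_piMl//; lra.
Qed.

Context (a r U : R).
Hypotheses (a_gt0 : 0 < a) (r_ge0 : 0 <= r) (rU : r <= U).
Hypothesis lower : forall v, a * dotv v v - r * l1norm v ^+ 2 <= qform A v.
Hypothesis upper : forall v, qform A v <= U * dotv v v + r * l1norm v ^+ 2.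
Hypothesis rSh : r * (#|Sh|%:R + 1) <= a / 8.
Hypothesis lambdaj_large : 8 * r * U ^+ 2 <= a * lambdaj ^+ 2.

Let U_ge0 : 0 <= U. Proof. exact: le_trans rU. Qed.

(** Since [kappa_j = 1], [M >= 1], and [qform A kappa >= a M - r |kappa|_1^2]. In the l1 norm the
    part over [j |: Sh] costs at most [a M / 4] by Cauchy-Schwarz and the penalised part at most
    [a / 4]. *)
Lemma kappa_diag_lower : a / 2 <= c j.
Proof.
apply: le_trans kappa_diag_ge.
have rN := rSh; set M := dotv kappa kappa; set N : R := #|Sh|%:R in rN *.
have M1 : 1 <= M.
  rewrite /M /dotv (bigD1 j)//= kappa_j mulr1 lerDl.
  by apply: sumr_ge0 => k _; rewrite -expr2 sqr_ge0.
have Ajj : qform A (delta_mx j 0) <= 2 * U.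
  apply: le_trans (upper _) _; rewrite dotv_deltal mxE !eqxx.
  have -> : l1norm (delta_mx j 0 : 'cV[R]_p) = 1.
    rewrite /l1norm (bigD1 j)//= mxE !eqxx normr1 big1 ?addr0// => k kj.
    by rewrite mxE (negbTE kj) normr0.
  by rewrite expr1n/= !mulr1; have := rU; lra.
(* [delta_mx j 0] is feasible with zero penalty, so its loss, at most [U], bounds the whole
   objective at [kappa]. *)
have penU : lambdaj * pen kappa <= U.
  have := kappa_min (v := delta_mx j 0); rewrite mxE !eqxx => /(_ erefl).
  have -> : pen (delta_mx j 0) = 0.
    by apply: big1 => k /andP[_ kj]; rewrite mxE (negbTE kj) normr0.
  by have := qform_gram_ge0 X kappa; rewrite -/A; lra.
have rpen : r * pen kappa ^+ 2 <= a / 8.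
  have l2 : 0 < lambdaj ^+ 2 by rewrite exprn_gt0.
  have e1 : (lambdaj * pen kappa) ^+ 2 <= U ^+ 2.
    by rewrite lerXn2r ?nnegrE ?mulr_ge0// ltW.
  have := ler_wpM2l r_ge0 e1; rewrite exprMn => e2.
  by rewrite -(ler_pM2l l2); have := lambdaj_large; lra.
pose x := \sum_(k in j |: Sh) `|kappa k 0|.
have x0 : 0 <= x by exact: sumr_ge0.
have l1E : l1norm kappa = x + pen kappa.
  rewrite (l1norm_setC (j |: Sh)); congr (_ + _); apply: eq_bigl => k.
  by rewrite !inE negb_or andbC.
have xM : x ^+ 2 <= (N + 1) * M.
  apply: le_trans (sqr_sum_norm_le _ _) _; apply: ler_wpM2r; first exact: dotvv_ge0.
  rewrite /N natr1 ler_nat cardsU1 -add1n leq_add2r; exact: leq_b1.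
have l1sq : l1norm kappa ^+ 2 <= 2 * ((N + 1) * M) + 2 * pen kappa ^+ 2.
  by rewrite l1E; have := sqr_ge0 (x - pen kappa); lra.
have e1 := ler_wpM2l r_ge0 l1sq.
have e2 : r * (N + 1) * M <= a / 8 * M by apply: ler_wpM2r rN; lra.
have e3 : a * 1 <= a * M by rewrite ler_wpM2l// ltW.
by have := lower kappa; rewrite -/M; lra.
Qed.

Lemma score_bias_le (x : 'cV[R]_p) :
  `|x j 0 - dotv (score X j kappa) (X *m x) / n%:R| <= 2 * lambdaj / a * l1norm x.
Proof.
have n0 : n%:R != 0 :> R by rewrite pnatr_eq0 -lt0n.
have D := kappa_diag_lower; have D0 : 0 < c j by apply: lt_le_trans D; rewrite divr_gt0.
have cE k : dotv (col k X) (X *m kappa) = n%:R * c k.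
  by rewrite -[c k](dotv_deltal k) dotv_gram mulmx_delta mulrA divff// mul1r.
have xE : dotv (X *m kappa) (X *m x) = n%:R * dotv x (A *m kappa).
  by rewrite dotv_gram mulrA divff// mul1r dotvC.
rewrite /score cE dotvZl xE.
have -> : x j 0 - n%:R / (n%:R * c j) * (n%:R * dotv x (A *m kappa)) / n%:R =
    (c j)^-1 * (x j 0 * c j - dotv x (A *m kappa)).
  by field; rewrite n0 gt_eqF.
rewrite /dotv (bigD1 j)//= -/(c j) opprD addrA subrr add0r normrM normrN.
rewrite [X in X * _]ger0_norm ?invr_ge0 ?(ltW D0)// -ler_pdivlMl ?invr_gt0// invrK.
apply: (@le_trans _ _ (lambdaj * l1norm x)).
  rewrite /l1norm mulr_sumr (le_trans (ler_norm_sum _ _ _))//.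
  rewrite [leRHS](bigD1 j)//= -[leLHS]add0r lerD ?mulr_ge0// ?(ltW lambdaj_gt0)//.
  apply: ler_sum => k kj; rewrite normrM mulrC ler_wpM2r//.
  apply: le_trans (kappa_kkt kj) _;
    rewrite -[leRHS]mulr1 ler_wpM2l ?(ltW lambdaj_gt0)//.
  by case: (k \notin Sh); rewrite ?ler01.
have l0 : 0 <= lambdaj * l1norm x by rewrite mulr_ge0 ?l1norm_ge0 ?(ltW lambdaj_gt0).
have -> : lambdaj * l1norm x = a / 2 * (2 * lambdaj / a * l1norm x) by field;
  rewrite gt_eqF.
apply: ler_wpM2r => //; rewrite !mulr_ge0 ?invr_ge0 ?l1norm_ge0// ltW//.
Qed.

End score.

(** * Deterministic bound on the remainder *)

Section remainder.
Context {R : realType} (n p : nat) (X : 'M[R]_(n, p)).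
Context (y eps w : 'cV[R]_n) (beta bhat bstar kappa : 'cV[R]_p) (j : 'I_p).
Context (lambda lambdaj : R).

Lemma BSDB_remainderE (x := 2 *: (bhat - beta) - (bstar - beta)) :
  y = X *m beta + eps ->
  BSDB X y j bhat bstar w - beta j 0 - dotv w eps / n%:R =
  x j 0 - dotv w (X *m x) / n%:R.
Proof.
move=> yE.
have xj : x j 0 = 2 * bhat j 0 - beta j 0 - bstar j 0 by rewrite /x !mxE; ring.
have e1 : dotv w (y - X *m bhat) = dotv w eps + dotv w (X *m beta) - dotv w (X *m bhat).
  by rewrite yE !dotvDr dotvNr; ring.
have e2 : dotv w (X *m (bhat - bstar)) = dotv w (X *m bhat) - dotv w (X *m bstar).
  by rewrite mulmxBr dotvDr dotvNr.
have e3 : dotv w (X *m x) =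
    2 * dotv w (X *m bhat) - dotv w (X *m beta) - dotv w (X *m bstar).
  rewrite /x mulmxBr -scalemxAr !mulmxBr dotvDr dotvNr dotvZr !dotvDr !dotvNr; ring.
rewrite /BSDB /mDB /boot_bias xj e1 e2 e3; ring.
Qed.

Hypotheses (n_gt0 : (0 < n)%N) (lambda_gt0 : 0 < lambda) (lambdaj_gt0 : 0 < lambdaj).
Hypothesis yE : y = X *m beta + eps.
Hypothesis noise : forall k, `|n%:R^-1 * dotv (col k X) eps| <= lambda / 2.
Hypothesis bhatP : is_lasso X y lambda bhat.
Hypothesis bstarP : is_lasso X (X *m bhat) lambda bstar.

Lemma BSDB_remainder0 : #|supp beta| = 0%N ->
  BSDB X y j bhat bstar w - beta j 0 - dotv w eps / n%:R = 0.
Proof.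
move=> s0; rewrite BSDB_remainderE//.
have [-> ->] := lasso_sparsity0 yE lambda_gt0 noise bhatP bstarP s0.
by rewrite !subrr scaler0 subrr mulmx0 dotv0r mul0r mxE subrr.
Qed.

Hypothesis kappaP : is_kappa X (supp bhat) j lambdaj kappa.

Let s : R := #|supp beta|%:R.

Lemma BSDB_remainder_le (a r U : R) : w = score X j kappa ->
  0 < a -> a <= U -> 0 <= r -> 1 <= s ->
  (forall v, a * dotv v v - r * l1norm v ^+ 2 <= qform (gram X) v) ->
  (forall v, qform (gram X) v <= U * dotv v v + r * l1norm v ^+ 2) ->
  r * s * (144 * U / a + 1) <= a / 144 ->
  8 * r * U ^+ 2 <= a * lambdaj ^+ 2 ->
  `|BSDB X y j bhat bstar w - beta j 0 - dotv w eps / n%:R| <=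
    180 / a ^+ 2 * lambda * lambdaj * s.
Proof.
move=> wE a0 aU r0 s1 low up small ljl.
have U0 : 0 < U by apply: lt_le_trans aU.
have rs0 : 0 <= r * s by rewrite mulr_ge0//; lra.
have f1 : 0 <= 144 * U / a by rewrite divr_ge0 ?mulr_ge0// ltW.
have e0 : 0 <= r * s * (144 * U / a) by rewrite mulr_ge0.
have rs_small : r * s <= a / 144 by lra.
have r_le : r * 1 <= r * s by rewrite ler_wpM2l.
have rU : r <= U by lra.
have shat := lasso_support_size yE lambda_gt0 noise bhatP a0 r0 (ltW U0) low up
  rs_small.
(* [1 <= s] turns the 1 contributed by coordinate [j] into a multiple of [s]. *)
have rSh : r * (#|supp bhat|%:R + 1) <= a / 8.
  apply: (@le_trans _ _ (r * (144 * U * s / a + s))).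
    by rewrite ler_wpM2l// lerD.
  have -> : r * (144 * U * s / a + s) = r * s * (144 * U / a + 1) by field;
    rewrite gt_eqF.
  lra.
have l1u := lasso_l1_error yE lambda_gt0 noise bhatP a0 r0 low rs_small.
have l1h := boot_lasso_l1_error yE lambda_gt0 noise bhatP bstarP a0 r0 low rs_small.
rewrite BSDB_remainderE// wE.
set x := 2 *: _ - _.
(* 90 = 2 * 24 + 42, from the l1 errors of [bhat] and [bstar]. *)
have l1x : l1norm x <= 90 * (lambda * s / a).
  apply: le_trans (l1normD _ _) _; rewrite -[- (_ - _)]scaleN1r !l1normZ normrN1 mul1r.
  by rewrite ger0_norm//; lra.
apply: le_trans (score_bias_le n_gt0 lambdaj_gt0 kappaP a0 r0 rU low up rSh ljl x) _.
have -> : 180 / a ^+ 2 * lambda * lambdaj * s =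
  2 * lambdaj / a * (90 * (lambda * s / a)).
  by field; rewrite gt_eqF.
by rewrite ler_wpM2l// divr_ge0 ?mulr_ge0// ltW.
Qed.

End remainder.

(** * High-probability events *)

Section union_bound.
Context d (T : measurableType d) (R : realType) (P : probability T R).

Lemma measurable_exists_set (I : finType) (B : I -> set T) :
  (forall i, measurable (B i)) -> measurable [set w | exists i, B i w].
Proof.
move=> mB; rewrite (_ : [set w | _] = \big[setU/set0]_(i <- enum I) B i).
  exact: bigsetU_measurable.
rewrite -bigcup_seq; apply/seteqP; split => w /=.
  by move=> [i Bi]; exists i => //=; rewrite mem_enum.
by move=> [i _ Bi]; exists i.
Qed.

Lemma union_bound (I : finType) (B : I -> set T) (c : R) :
  (forall i, measurable (B i)) -> (forall i, P (B i) <= c%:E)%E ->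
  (P [set w | exists i, B i w] <= (#|I|%:R * c)%:E)%E.
Proof.
move=> mB Bc.
have -> : [set w | exists i, B i w] = \big[setU/set0]_(i <- enum I) B i.
  rewrite -bigcup_seq; apply/seteqP; split => w /=.
    by move=> [i Bi]; exists i => //=; rewrite mem_enum.
  by move=> [i _ Bi]; exists i.
rewrite cardE; elim: (enum I) => [|i s IH].
  by rewrite big_nil measure0 mul0r.
rewrite big_cons /= -natr1 addrC mulrDl mul1r EFinD.
apply: le_trans (measureU2 _ _ _) _; [exact: mB|exact: bigsetU_measurable|].
by apply: leeD; [exact: Bc|exact: IH].
Qed.

End union_bound.

(** * Correlations between noise and design *)

Section noise.
Local Open Scope ereal_scope.
Context d (T : measurableType d) (R : realType) (P : probability T R).
Context (n p : nat) (X : {RV P >-> n.-tuple (p.-tuple R)}) (eps : {RV P >->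
  n.-tuple R}).
Context (Sigma : 'M[R]_p) (Cmin Cmax K1 K K2 Ke sigma L : R).
Hypothesis designX : subgaussian_design X Sigma Cmin Cmax K1.
Hypothesis errorsE : subgaussian_errors eps sigma K2.
Hypothesis indepXE : indep2 P X eps.
Hypotheses (K_gt0 : (0 < K)%R) (K1K : (K1 <=
  K)%R) (Ke_gt0 : (0 < Ke)%R) (K2Ke : (K2 <= Ke)%R).
Hypotheses (L_gt0 : (0 < L)%R) (CmaxL : (Cmax <= L)%R).

Let err i w := tnth (eps w) i.

Lemma measurable_error i : measurable_fun setT (err i).
Proof. by apply: (measurableT_comp (measurable_tnth i)). Qed.

Lemma errors_upper_tail :
  P [set w | (32 * Ke ^+ 2 * n%:R <= \sum_i tnth (eps w) i ^+ 2)%R] <=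
    (expR (- n%:R))%:E.
Proof.
have [[indE _] _ _ psiE] := errorsE.
pose t := ((16 * Ke ^+ 2)^-1)%R.
have Ke2 : (0 < Ke ^+ 2)%R by rewrite exprn_gt0.
have t0 : (0 < t)%R by rewrite invr_gt0 !mulr_gt0.
have tE : (16 * Ke ^+ 2 * t = 1)%R by rewrite /t; field; rewrite !gt_eqF.
have := @chernoff_sum _ _ _ P _ _ _ err (fun _ x => t * x ^+ 2)%R 1%R
  (t * (32 * Ke ^+ 2 * n%:R))%R.
move=> /(_ measurable_error indE) h.
have -> : [set w | (32 * Ke ^+ 2 * n%:R <= \sum_i tnth (eps w) i ^+ 2)%R] =
    [set w | (t * (32 * Ke ^+ 2 * n%:R) <= \sum_i t * err i w ^+ 2)%R].
  by apply/seteqP; split => w /=; rewrite -mulr_sumr ler_pM2l.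
have -> : (- n%:R = n%:R * 1 - t * (32 * Ke ^+ 2 * n%:R))%R.
  by rewrite /t; field; rewrite !gt_eqF.
apply: h => i; first by apply: measurable_funM => //; exact: measurable_funX.
rewrite -tE; apply: integral_expR_sqr_le; rewrite ?tE//; last 2 first.
- apply: psi2_subgaussian_moments; first exact: ltW.
  by apply: le_trans (psiE i) _; rewrite lee_fin.
- exact: ltW.
exact: measurable_error.
Qed.

Let prodXE k w := (\sum_i tnth (tnth (X w) i) k * tnth (eps w) i)%R.

Let tau := (K ^+ 2 * L)%R.

Let tau_gt0 : (0 < tau)%R. Proof. by rewrite mulr_gt0// exprn_gt0. Qed.

(** For frozen errors the sum is a weighted sum of independent centred sub-Gaussian entries, with
    log-moment at most [36 tau theta^2] times the sum of squared errors. Subtracting this makes the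
    bound uniform in the errors, whose squares are controlled separately. *)
Lemma noise_mgf k (theta : R) :
  \int[P]_w (expR (theta * prodXE k w - 36 * tau * theta ^+ 2 * \sum_i tnth (eps
    w) i ^+ 2))%:E
  <= 1%:E.
Proof.
pose f (z : n.-tuple R * n.-tuple (p.-tuple R)) :=
  expR (theta * (\sum_i tnth (tnth z.2 i) k * tnth z.1 i) -
        36 * tau * theta ^+ 2 * \sum_i tnth z.1 i ^+ 2)%R.
have m1 i : measurable_fun setT (fun z : n.-tuple R * n.-tuple (p.-tuple R) =>
  tnth z.1 i).
  exact: (measurableT_comp (measurable_tnth i)).
have m2 i : measurable_fun setT (fun z : n.-tuple R * n.-tuple (p.-tuple R) =>
  tnth (tnth z.2 i) k).
  by apply: (measurableT_comp (measurable_tnth k));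
    exact: (measurableT_comp (measurable_tnth i)).
apply: (indep2_integral_le (f := f) indepXE).
- apply: measurableT_comp; first exact: measurable_expR.
  apply: measurable_funB; apply: measurable_funM => //.
    by apply: measurable_sum => i; exact: measurable_funM.
  by apply: measurable_sum => i; exact: measurable_funX.
- by move=> z; exact: expR_ge0.
move=> e; rewrite /f/=.
pose g (i : 'I_n) (t : p.-tuple R) :=
  expR ((theta * tnth e i) * dotv (delta_mx k 0%R) (col_of_tuple t)).
pose c := expR (- (36 * tau * theta ^+ 2 * \sum_i tnth e i ^+ 2)).
have fE w : expR (theta * (\sum_i tnth (tnth (X w) i) k * tnth e i) -
        36 * tau * theta ^+ 2 * \sum_i tnth e i ^+ 2)%R =
          (c * \prod_i g i (tnth (X w) i))%R.
  rewrite expRD mulrC -expR_sum; congr (_ * expR _)%R.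
  rewrite mulr_sumr; apply: eq_bigr => i _; rewrite dotv_deltal mxE; ring.
under eq_integral do rewrite fE EFinM.
have [[indX _] _ _ _ _] := designX.
have mg i : measurable_fun setT (g i).
  apply: measurableT_comp; first exact: measurable_expR.
  by apply: measurable_funM => //; exact: measurable_lin.
have gM := @mutually_indep_integral_prod_le _ _ _ P _ _ _ (fun i w => tnth (X w) i) g
  (fun i => expR (36 * tau * (theta * tnth e i) ^+ 2))
  (@measurable_row _ _ _ P _ _ X) indX mg (fun i t => expR_ge0 _).
rewrite ge0_integralZl_EFin ?expR_ge0//; last 2 first.
- by move=> w _; rewrite lee_fin prodr_ge0// => i _; exact: expR_ge0.
- apply/measurable_EFinP; apply: measurable_prod => i _.
  by apply: measurableT_comp; [exact: mg|exact: measurable_row].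
apply: (@le_trans _ _ (c%:E * (\prod_i expR (36 * tau * (theta * tnth e i) ^+ 2))%:E)).
  apply: lee_wpmul2l; first by rewrite lee_fin expR_ge0.
  apply: gM => i; apply: le_trans (design_expR designX K_gt0 K1K _ _
    (delta_cV_neq0 R k)) _.
  rewrite lee_fin ler_expR; apply: ler_wpM2r; first exact: sqr_ge0.
  apply: ler_wpM2l => //; apply: ler_wpM2l; first exact: sqr_ge0.
  apply: le_trans (design_qform_le designX _) _.
  by rewrite dotv_deltal mxE !eqxx mulr1.
rewrite -EFinM -expR_sum -expRD lee_fin -[leRHS]expR0 ler_expR.
rewrite mulr_sumr addrC subr_le0; apply: ler_sum => i _.
by rewrite exprMn mulrA.
Qed.

Lemma measurable_prodXE k : measurable_fun setT (prodXE k).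
Proof.
apply: measurable_sum => i; apply: measurable_funM; last exact: measurable_error.
by apply: (measurableT_comp (measurable_tnth k)); exact: measurable_row.
Qed.

Lemma measurable_noise_event b :
  measurable [set w | exists k, (b <= `|prodXE k w|)%R].
Proof.
apply: measurable_exists_set => k; apply: measurable_set_ler => //.
by apply: measurableT_comp => //; exact: measurable_prodXE.
Qed.

Lemma noise_tail (b : R) : (0 < n)%N -> (0 < b)%R ->
  P [set w | exists k, (b <= `|prodXE k w|)%R] <=
  (expR (- n%:R) + (2 * p)%:R * expR (- (b ^+ 2 / (2 * 48 ^+ 2 * tau * Ke ^+ 2 *
    n%:R))))%:E.
Proof.
move=> n0 b0.
have nR : (0 < n%:R :> R)%R by rewrite ltr0n.
have Ke2 : (0 < Ke ^+ 2)%R by rewrite exprn_gt0.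
pose V := (32 * Ke ^+ 2 * n%:R)%R.
have V0 : (0 < V)%R by rewrite /V !mulr_gt0.
(* The maximiser of [theta b - 36 tau theta^2 V], with value [b^2 / (144 tau V)]; 144 * 32 = 2 *
   48^2. *)
pose theta := (b / (72 * tau * V))%R.
have theta0 : (0 < theta)%R by rewrite divr_gt0// !mulr_gt0.
pose sq w := (\sum_i tnth (eps w) i ^+ 2)%R.
have msq : measurable_fun setT sq.
  by apply: measurable_sum => i; apply: measurable_funX; exact: measurable_error.
pose h (ks : 'I_p * bool) w :=
  (((-1) ^+ ks.2 * theta) * prodXE ks.1 w - 36 * tau * ((-1) ^+ ks.2 * theta) ^+
    2 * sq w)%R.
have mh ks : measurable_fun setT (h ks).
  by apply: measurable_funB; apply: measurable_funM => //; exact: measurable_prodXE.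
pose a := (theta * b - 36 * tau * theta ^+ 2 * V)%R.
have aE : (a = b ^+ 2 / (2 * 48 ^+ 2 * tau * Ke ^+ 2 * n%:R))%R.
  by rewrite /a /theta /V; field; rewrite !gt_eqF.
pose B ks := [set w | (a <= h ks w)%R].
have mB ks : measurable (B ks) by exact: measurable_set_ler.
have PB ks : P (B ks) <= (expR (- a))%:E.
  rewrite -[X in expR X]sub0r; apply: chernoff_ge => //.
  by rewrite expR0; exact: noise_mgf.
have mV : measurable [set w | (V <= sq w)%R] by exact: measurable_set_ler.
apply: (@le_trans _ _ (P ([set w | (V <= sq w)%R] `|` [set w | exists ks, B ks w]))).
  apply: le_measure; rewrite ?inE; first exact: measurable_noise_event.
    by apply: measurableU => //; exact: measurable_exists_set.
  move=> w /= [k bk]; have [|sqV] := lerP V (sq w); first by left.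
  right; exists (k, (prodXE k w < 0)%R); rewrite /B /h /a/=.
  have -> : ((-1) ^+ (prodXE k w < 0)%R * theta * prodXE k w = theta * `|prodXE k w|)%R.
    by rewrite normrEsign; ring.
  have sg2 (c : bool) (x : R) : (((-1) ^+ c * x) ^+ 2 = x ^+ 2)%R.
    by rewrite exprMn sqrr_sign mul1r.
  rewrite sg2.
  have e1 : (theta * b <= theta * `|prodXE k w|)%R by rewrite ler_pM2l.
  have e2 : (36 * tau * theta ^+ 2 * sq w <= 36 * tau * theta ^+ 2 * V)%R.
    apply: ler_wpM2l; last exact: ltW.
    by rewrite -mulrA mulr_ge0// (mulr_ge0 (ltW tau_gt0) (sqr_ge0 theta)).
  lra.
apply: le_trans (measureU2 _ _ _) _ => //; first exact: measurable_exists_set.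
rewrite EFinD; apply: leeD; first exact: errors_upper_tail.
rewrite -aE; apply: le_trans (union_bound mB PB) _.
by rewrite card_prod card_ord card_bool mulnC.
Qed.

End noise.

Lemma qform_gram_rows (R : realType) n p (x : n.-tuple (p.-tuple R)) (u : 'cV[R]_p) :
  qform (gram (mx_of_rows x)) u =
  n%:R^-1 * \sum_i dotv u (col_of_tuple (tnth x i)) ^+ 2.
Proof.
rewrite qform_gram sqr_l2norm; congr (_ * _); apply: eq_bigr => i _.
rewrite -expr2; congr (_ ^+ 2); rewrite mxE dotvC.
by apply: eq_bigr => k _; rewrite !mxE.
Qed.

(** * The two-sided bound for a random design *)

Section design_event.
Local Open Scope ereal_scope.
Context d (T : measurableType d) (R : realType) (P : probability T R).
Context (n p m : nat) (X : {RV P >-> n.-tuple (p.-tuple R)}) (Sigma : 'M[R]_p).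
Context (Cmin Cmax K1 K L : R).
Hypothesis designX : subgaussian_design X Sigma Cmin Cmax K1.
Hypotheses (K_gt0 : (0 < K)%R) (K1K : (K1 <= K)%R) (CmaxL : (Cmax <= L)%R).
Hypotheses (n_gt0 : (0 < n)%N) (m_gt1 : (1 < m)%N).

Let Q u w := (\sum_i dotv u (col_of_tuple (tnth (X w) i)) ^+ 2)%R.

(** Signed sums can cancel to 0; both inequalities then read [0 <= 0] and hold surely, so that case
    must be excluded from the failure. *)
Definition net_failure (s : m.-tuple ('I_p * bool)) : set T :=
  let u := signed_sum (R := R) s in
  [set w | u != 0%R /\ ((Q u w <= n%:R * dotv u (Sigma *m u) / 2)%R \/
                 (32 * K ^+ 2 * (n%:R * dotv u (Sigma *m u)) <= Q u w)%R)].

Definition design_failure : set T := [set w | exists s, net_failure s w].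

Let mQ u : measurable_fun setT (Q u).
Proof.
by apply: measurable_sum => i; apply: measurable_funX; exact: measurable_lin_row.
Qed.

Let measurable_net_failure s : measurable (net_failure s).
Proof.
rewrite /net_failure; set u := signed_sum _.
have [->|u0] := eqVneq u 0%R.
  by rewrite (_ : [set w | _] = set0)//; apply/seteqP; split => w //= -[].
rewrite (_ : [set w | _] = [set w | (Q u w <= n%:R * dotv u (Sigma *m u) / 2)%R] `|`
    [set w | (32 * K ^+ 2 * (n%:R * dotv u (Sigma *m u)) <= Q u w)%R]).
  by apply: measurableU; apply: measurable_set_ler.
by apply/seteqP; split => w /= => [[]|].
Qed.

Lemma measurable_design_failure : measurable design_failure.
Proof. exact: measurable_exists_set. Qed.

Lemma design_failure_le : P design_failure <=
  ((p * 2) ^ m)%:R%:E * (expR (- (n%:R / (256 * K ^+ 4))) + expR (- n%:R))%:E.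
Proof.
rewrite -EFinM.
have -> : ((p * 2) ^ m)%N = #|{: m.-tuple ('I_p * bool)}|.
  by rewrite card_tuple card_prod card_ord card_bool.
apply: union_bound => // s; rewrite /net_failure; set u := signed_sum _.
have [u0|u0] := eqVneq u 0%R.
  rewrite (_ : [set w | _] = set0) ?measure0 ?lee_fin ?addr_ge0 ?expR_ge0//.
  by apply/seteqP; split => w //= -[].
rewrite (_ : [set w | _] = [set w | (Q u w <= n%:R * dotv u (Sigma *m u) / 2)%R] `|`
    [set w | (32 * K ^+ 2 * (n%:R * dotv u (Sigma *m u)) <= Q u w)%R]); last first.
  by apply/seteqP; split => w /= => [[]|].
apply: le_trans (measureU2 _ _ _) _; [exact: measurable_set_ler..|].
rewrite EFinD; apply: leeD.
  exact: (design_lower_tail designX).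
exact: (design_upper_tail designX).
Qed.

Lemma gram_bounds w (r : R) (A := gram (mx_of_rows (X w))) : ~ design_failure w ->
  (32 * K ^+ 2 * L <= r * (m%:R - 1))%R ->
  (forall v, Cmin / 2 * dotv v v - r * l1norm v ^+ 2 <= qform A v)%R /\
  (forall v, qform A v <= 32 * K ^+ 2 * L * dotv v v + r * l1norm v ^+ 2)%R.
Proof.
move=> good rm.
have nR : (0 < n%:R :> R)%R by rewrite ltr0n.
have C0 : (0 <= 32 * K ^+ 2)%R by rewrite mulr_ge0// sqr_ge0.
have m1R : (0 < m%:R - 1 :> R)%R by rewrite subr_gt0 ltr1n.
have qpos v : (0 <= qform Sigma v <= L * dotv v v)%R.
  apply/andP; split.
    have [->|v0] := eqVneq v 0%R; first by rewrite qform0.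
    exact/ltW/(design_qform_gt0 designX).
  apply: le_trans (design_qform_le designX v) _.
  by apply: ler_wpM2r => //; exact: dotvv_ge0.
have net (s : seq ('I_p * bool)) : size s = m ->
    (qform Sigma (signed_sum s) / 2 <= qform A (signed_sum s))%R /\
    (qform A (signed_sum s) <= 32 * K ^+ 2 * qform Sigma (signed_sum s))%R.
  move=> /eqP ss; set u := signed_sum s.
  have [->|u0] := eqVneq u 0%R; first by rewrite !qform0 mul0r mulr0.
  have QA : Q u w = (n%:R * qform A u)%R.
    by rewrite /A qform_gram_rows mulrA divff ?mul1r// gt_eqF.
  have bs : ~ net_failure (Tuple ss) w by move=> h; apply: good; exists (Tuple ss).
  split; rewrite leNgt; apply/negP => h; apply: bs; split => //=; rewrite -/u QA.
    by left; rewrite -mulrA ler_pM2l// ltW.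
  by right; rewrite mulrCA ler_pM2l// ltW.
have [low up] : (forall v, qform Sigma v / 2 - 32 * K ^+ 2 * L / (m%:R - 1) *
  l1norm v ^+ 2 <= qform A v)%R /\
   (forall v, qform A v <= 32 * K ^+ 2 * qform Sigma v + 32 * K ^+ 2 * L / (m%:R
     - 1) * l1norm v ^+ 2)%R.
  by split => v; have [] := qform_net_bounds (gram_sym _) (design_sym designX)
    m_gt1 C0 qpos
    (fun s ss => (net s ss).1) (fun s ss => (net s ss).2) v.
have rl (v : 'cV[R]_p) : (32 * K ^+ 2 * L / (m%:R - 1) * l1norm v ^+ 2 <=
  r * l1norm v ^+ 2)%R.
  by apply: ler_wpM2r; [exact: sqr_ge0|rewrite ler_pdivrMr].
split => v.
  have := low v; have := rl v; have := design_qform_ge designX v;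
    rewrite -/(qform _ _); lra.
have := up v; have := rl v; have /andP[_ /(ler_wpM2l C0)] := qpos v; lra.
Qed.

End design_event.

(** * Measurability of the remainder *)

Section measurability.
Context d (T : measurableType d) (R : realType).

(** [x^-1 = x * (x^2)^-1] reduces inversion to a real power of a nonnegative number; at 0 it agrees
    with the convention [0^-1 = 0]. *)
Lemma measurable_invr : measurable_fun [set: R] (fun x : R => x^-1).
Proof.
rewrite (_ : (fun x => _) = (fun x : R => x * powR (x ^+ 2) (- 1))).
  apply: measurable_funM => //; apply: (measurableT_comp (measurable_powR _)).
  exact: measurable_funX.
apply/funext => x; rewrite powR_inv1 ?sqr_ge0//.
by have [->|x0] := eqVneq x 0; [rewrite invr0 mul0r|field].
Qed.

Definition measurable_cV m (V : T -> 'cV[R]_m) :=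
  forall i, measurable_fun setT (fun w => V w i 0).

Lemma measurable_dotv m (U V : T -> 'cV[R]_m) : measurable_cV U -> measurable_cV V ->
  measurable_fun setT (fun w => dotv (U w) (V w)).
Proof. by move=> mU mV; apply: measurable_sum => i; exact: measurable_funM. Qed.

Lemma measurable_mulmx m k (A : T -> 'M[R]_(m, k)) (V : T -> 'cV[R]_k) :
  (forall i l, measurable_fun setT (fun w => A w i l)) -> measurable_cV V ->
  measurable_cV (fun w => A w *m V w).
Proof.
move=> mA mV i; under eq_fun do rewrite mxE.
by apply: measurable_sum => l; exact: measurable_funM.
Qed.

Lemma measurable_col_of_tuple m (V : T -> m.-tuple R) : measurable_fun setT V ->
  measurable_cV (fun w => col_of_tuple (V w)).
Proof.
by move=> mV i; under eq_fun do rewrite mxE;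
  apply: (measurableT_comp (measurable_tnth i)).
Qed.

Lemma measurable_mx_of_rows m k (A : T -> m.-tuple (k.-tuple R)) i l :
  measurable_fun setT A -> measurable_fun setT (fun w => mx_of_rows (A w) i l).
Proof.
move=> mA; under eq_fun do rewrite mxE; apply: (measurableT_comp (measurable_tnth l)).
exact: (measurableT_comp (measurable_tnth i)).
Qed.

Lemma measurable_score n p (X : T -> 'M[R]_(n, p)) (j : 'I_p) (kappa : T -> 'cV[R]_p) :
  (forall i l, measurable_fun setT (fun w => X w i l)) -> measurable_cV kappa ->
  measurable_cV (fun w => score (X w) j (kappa w)).
Proof.
move=> mX mk; have mXk := measurable_mulmx mX mk.
move=> i; under eq_fun do rewrite mxE; apply: measurable_funM => //.
apply: measurable_funM => //; apply: (measurableT_comp measurable_invr).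
by apply: measurable_dotv => // l; under eq_fun do rewrite mxE; exact: mX.
Qed.

(** Monotonicity of [P] compares measurable sets, so the event that the remainder is large must
    itself be measurable before it is included in the failure events. *)
Lemma measurable_BSDB_remainder n p (X : T -> 'M[R]_(n, p)) (y eps w : T -> 'cV[R]_n)
    (beta : 'cV[R]_p) (j : 'I_p) (bhat bstar : T -> 'cV[R]_p) :
  (forall i l, measurable_fun setT (fun t => X t i l)) ->
  measurable_cV w -> measurable_cV bhat -> measurable_cV bstar ->
  (forall t, y t = X t *m beta + eps t) ->
  measurable_fun setT (fun t => BSDB (X t) (y t) j (bhat t) (bstar t) (w t)
    - beta j 0 - dotv (w t) (eps t) / n%:R).
Proof.
move=> mX mw mbh mbs yE; under eq_fun do rewrite (BSDB_remainderE _ _ _ _ (yE _)).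
have mx : measurable_cV (fun t => 2 *: (bhat t - beta) - (bstar t - beta)).
  move=> i; under eq_fun do rewrite !mxE.
  by apply: measurable_funB; [apply: measurable_funM => //|]; exact: measurable_funB.
apply: measurable_funB; first exact: mx.
by apply: measurable_funM => //; apply: measurable_dotv => //; exact: measurable_mulmx.
Qed.

End measurability.

(** * Finite-sample tail of the remainder *)

Section tail.
Context d (T : measurableType d) (R : realType) (P : probability T R).
Context (n p : nat) (X : {RV P >-> n.-tuple (p.-tuple R)}) (eps : {RV P >->
  n.-tuple R}).
Context (bhat kappa bstar : {RV P >-> p.-tuple R}).
Context (beta : 'cV[R]_p) (Sigma : 'M[R]_p) (j : 'I_p).
Context (Cmin Cmax K1 K K2 Ke sigma L c1 c2 : R).

Let s : R := #|supp beta|%:R.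
Let delta : R := ln p%:R / n%:R.
Let lambda := c1 * Num.sqrt delta.
Let lambdaj := c2 * Num.sqrt delta.
Let Xm w := mx_of_rows (X w).
Let epsv w := col_of_tuple (eps w).
Let y w := Xm w *m beta + epsv w.
Let bh w := col_of_tuple (bhat w).
Let ka w := col_of_tuple (kappa w).
Let bs w := col_of_tuple (bstar w).
Let wh w := score (Xm w) j (ka w).

Hypothesis designX : subgaussian_design X Sigma Cmin Cmax K1.
Hypothesis errorsE : subgaussian_errors eps sigma K2.
Hypothesis indepXE : indep2 P X eps.
Hypothesis bhatP : forall w, is_lasso (Xm w) (y w) lambda (bh w).
Hypothesis kappaP : forall w, is_kappa (Xm w) (supp (bh w)) j lambdaj (ka w).
Hypothesis bstarP : forall w, is_lasso (Xm w) (Xm w *m bh w) lambda (bs w).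
Hypotheses (K_ge1 : 1 <= K) (K1K : K1 <= K) (Ke_gt0 : 0 < Ke) (K2Ke : K2 <= Ke).
Hypotheses (Cmin_gt0 : 0 < Cmin) (CminL : Cmin <= L) (CmaxL : Cmax <= L).
Hypotheses (n_gt0 : (0 < n)%N) (p_gt1 : (1 < p)%N).

(** [a], [U] and [r] are the constants of the two-sided bound and [c0] is the rate of
    [design_lower_tail]. The factor [8 / c0] in [Cr] yields [U <= r (m - 1)], because
    [m - 1 >= c0 / (8 delta)] for the [m] chosen below. *)
Let a := Cmin / 2.
Let U := 32 * K ^+ 2 * L.
Let c0 := (256 * K ^+ 4)^-1.
Let Cr := U * (8 / c0).
Let r := Cr * delta.

Hypotheses (c1_gt0 : 0 < c1) (c1_large : 192 ^+ 2 * (K ^+ 2 * L) * Ke ^+ 2 <= c1 ^+ 2).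
Hypotheses (c2_gt0 : 0 < c2) (c2_large : 8 * Cr * U ^+ 2 <= a * c2 ^+ 2).
Hypothesis sparse : 0 < s -> delta <=
  c0 / 16 /\ Cr * (s * delta) * (144 * U / a + 1) <= a / 144.

Let K_gt0 : 0 < K. Proof. exact: lt_le_trans K_ge1. Qed.
Let L_gt0 : 0 < L. Proof. exact: lt_le_trans CminL. Qed.
Let nR : 0 < n%:R :> R. Proof. by rewrite ltr0n. Qed.
Let pR : 1 < p%:R :> R. Proof. by rewrite ltr1n. Qed.
Let lnp : 0 < ln p%:R :> R. Proof. exact: ln_gt0. Qed.
Let delta_gt0 : 0 < delta. Proof. exact: divr_gt0. Qed.
Let sqd_gt0 : 0 < Num.sqrt delta. Proof. by rewrite sqrtr_gt0. Qed.
Let lambda_gt0 : 0 < lambda. Proof. exact: mulr_gt0. Qed.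
Let lambdaj_gt0 : 0 < lambdaj. Proof. exact: mulr_gt0. Qed.
Let a_gt0 : 0 < a. Proof. exact: divr_gt0. Qed.
Let K2_gt0 : 0 < K ^+ 2. Proof. exact: exprn_gt0. Qed.
Let U_gt0 : 0 < U. Proof. by rewrite /U !mulr_gt0. Qed.
Let c0_gt0 : 0 < c0. Proof. by rewrite invr_gt0 mulr_gt0// exprn_gt0. Qed.
Let Cr_gt0 : 0 < Cr. Proof. by rewrite mulr_gt0// divr_gt0. Qed.
Let r_ge0 : 0 <= r. Proof. by rewrite mulr_ge0// ltW. Qed.
Let sqdE : Num.sqrt delta ^+ 2 = delta. Proof. by rewrite sqr_sqrtr// ltW. Qed.

Let noise_event := [set w | exists k,
  n%:R * lambda / 2 <= `|\sum_i tnth (tnth (X w) i) k * tnth (eps w) i|].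

Let noiseP w : ~ noise_event w ->
  forall k, `|n%:R^-1 * dotv (col k (Xm w)) (epsv w)| <= lambda / 2.
Proof.
move=> good k; rewrite leNgt; apply/negP => h; apply: good; exists k.
have -> : \sum_i tnth (tnth (X w) i) k * tnth (eps w) i = dotv (col k (Xm w)) (epsv w).
  by apply: eq_bigr => i _; rewrite !mxE.
move: h; rewrite normrM ger0_norm ?invr_ge0// ltr_pdivlMl// => /ltW.
by rewrite mulrA.
Qed.

Let noise_event_le : (P noise_event <= (expR (- n%:R) + 2 / p%:R)%:E)%E.
Proof.
have b0 : 0 < n%:R * lambda / 2 by rewrite divr_gt0// mulr_gt0.
apply: le_trans (noise_tail designX errorsE indepXE K_gt0 K1K Ke_gt0 K2Ke L_gt0
  CmaxL n_gt0 b0) _.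
rewrite lee_fin lerD2l.
set e := _ ^+ 2 / _.
have Ke2 : 0 < Ke ^+ 2 by rewrite exprn_gt0.
(* Here [e = c1^2 ln p / (2 * 96^2 K^2 L Ke^2)], so 192^2 = 4 * 96^2 in the bound on [c1] gives
   [2 ln p], and the union over [2 p] signed coordinates costs [2 / p]. *)
have e2 : 2 * ln p%:R <= e.
  have -> : e = c1 ^+ 2 / (2 * 96 ^+ 2 * (K ^+ 2 * L) * Ke ^+ 2) * ln p%:R.
    have -> : e = n%:R ^+ 2 * c1 ^+ 2 * (Num.sqrt delta ^+ 2) / 4 / (2 * 48 ^+ 2
      * (K ^+ 2 * L) * Ke ^+ 2 * n%:R).
      by rewrite /e /lambda; field; rewrite !gt_eqF.
    by rewrite sqdE /delta; field; rewrite !gt_eqF.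
  apply: ler_wpM2r; first exact: ltW.
  by rewrite ler_pdivlMr ?mulr_gt0//; move: c1_large; lra.
apply: (@le_trans _ _ ((2 * p)%:R * expR (- (2 * ln p%:R)))).
  by apply: ler_wpM2l => //; rewrite ler_expR lerN2.
have p0 : 0 < p%:R :> R by exact: lt_trans pR.
rewrite expRN expRM_natl lnK ?posrE// natrM le_eqVlt; apply/orP; left; apply/eqP.
by field; rewrite gt_eqF.
Qed.

(** As [2 p <= p^2], there are at most [expR (2 m ln p) <= expR (c0 n / 2)] sums, which uses up half
    of the tail exponent [c0 n]. *)
Let m := Num.truncn (c0 * n%:R / (4 * ln p%:R)).

Let x := c0 / (4 * delta).

Let xE : c0 * n%:R / (4 * ln p%:R) = x.
Proof. by rewrite /x /delta; field; rewrite !gt_eqF. Qed.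

Let m_itv : m%:R <= x < m.+1%:R.
Proof. by rewrite /m xE truncn_itv// divr_ge0 ?mulr_ge0// ltW. Qed.

(** Truncation gives only [m > x - 1]; from 4 on, [x - 2 >= x / 2], hence [m - 1 >= x / 2]. This is
    the origin of [c0 / 16] in [sparse]. *)
Let x_ge4 : 0 < s -> 4 <= x.
Proof.
move=> /sparse[dc _]; have d4 : 0 < 4 * delta by rewrite pmulr_rgt0.
rewrite ler_pdivlMr//.
by move: (delta) (c0) dc => D C; lra.
Qed.

Let m_gt1 : 0 < s -> (1 < m)%N.
Proof.
move=> /x_ge4 x4; have /andP[_ xm] := m_itv.
have := le_lt_trans x4 xm; rewrite (ltr_nat R 4) ltnS; exact: leq_trans.
Qed.

Let rm : 0 < s -> U <= r * (m%:R - 1).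
Proof.
move=> /x_ge4 x4; have /andP[_] := m_itv; rewrite -natr1 => xm.
have h : x / 2 <= m%:R - 1 by move: (x) (m%:R) x4 xm => x' m' x4 xm; lra.
apply: (@le_trans _ _ (r * (x / 2))); last exact: ler_wpM2l.
by rewrite le_eqVlt /r /Cr /x; apply/orP; left; apply/eqP; field; rewrite !gt_eqF.
Qed.

Let design_event := design_failure m X Sigma K.

Let design_event_le : (P design_event <= (2 * expR (- (c0 * n%:R / 2)))%:E)%E.
Proof.
apply: le_trans (design_failure_le m designX K_gt0 K1K) _.
rewrite -EFinM lee_fin.
have c01 : c0 <= 1.
  rewrite invf_le1 ?mulr_gt0 ?exprn_gt0//.
  by have := exprn_ege1 4 K_ge1; lra.
have e1 : n%:R / (256 * K ^+ 4) = c0 * n%:R by rewrite mulrC.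
have e2 : expR (- (n%:R / (256 * K ^+ 4))) + expR (- n%:R) <= 2 * expR (- (c0 * n%:R)).
  rewrite e1; suff : expR (- n%:R) <= expR (- (c0 * n%:R)) by lra.
  by rewrite ler_expR lerN2 ler_piMl// ltW.
have p0 : 0 < p%:R :> R by exact: lt_trans pR.
have e3 : ((p * 2) ^ m)%:R <= expR (c0 * n%:R / 2) :> R.
  apply: (@le_trans _ _ (expR (m%:R * (2 * ln p%:R)))).
    rewrite expRM_natl (expRM_natl 2) lnK ?posrE// natrX lerXn2r ?nnegrE ?exprn_ge0//.
    by rewrite natrM expr2 ler_pM2l// ler_nat.
  rewrite ler_expR; have /andP[mx _] := m_itv.
  apply: (@le_trans _ _ (x * (2 * ln p%:R))); first by apply: ler_wpM2r => //;
    rewrite mulr_ge0// ltW.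
  by rewrite -xE le_eqVlt; apply/orP; left; apply/eqP; field; rewrite gt_eqF.
apply: (@le_trans _ _ (expR (c0 * n%:R / 2) * (2 * expR (- (c0 * n%:R))))).
  by apply: ler_pM => //; rewrite addr_ge0 ?expR_ge0.
rewrite mulrCA -expRD ler_pM2l// ler_expR; lra.
Qed.

Lemma BSDB_tail :
  (P [set w | (180 / a ^+ 2 * c1 * c2 * (s * ln p%:R / n%:R) <
     `|BSDB (Xm w) (y w) j (bh w) (bs w) (wh w) - beta j 0 - dotv (wh w) (epsv w)
       / n%:R|)%R] <=
  (expR (- n%:R) + 2 / p%:R + 2 * expR (- (c0 * n%:R / 2)))%:E)%E.
Proof.
set E := [set w | _].
have mX i l : measurable_fun setT (fun w => Xm w i l) by exact: measurable_mx_of_rows.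
have mE : measurable E.
  apply: measurable_set_ltr => //; apply: measurableT_comp => //.
  apply: measurable_BSDB_remainder => //; try exact: measurable_col_of_tuple.
  by apply: measurable_score => //; exact: measurable_col_of_tuple.
have mN : measurable noise_event by exact: measurable_noise_event.
have mD : measurable design_event by exact: measurable_design_failure.
(* For [s = 0] the threshold is 0 and [E] says that the remainder is nonzero, which the noise event
   alone has to cover. *)
have [s0|s0] := posnP #|supp beta|.
  apply: (@le_trans _ _ (P noise_event)).
    apply: le_measure; rewrite ?inE// => w Ew; apply: contrapT => /noiseP noise.
    move: Ew; rewrite /E/= (BSDB_remainder0 _ _ lambda_gt0 erefl noise (bhatP w)
      (bstarP w) s0).
    by rewrite normr0 /s s0 !mul0r mulr0 ltxx.
  by apply: le_trans noise_event_le _; rewrite lee_fin lerDl mulr_ge0// expR_ge0.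
have s1 : 1 <= s by rewrite ler1n.
have sp : 0 < s by exact: lt_le_trans s1.
apply: (@le_trans _ _ (P (noise_event `|` design_event))).
  apply: le_measure; rewrite ?inE//; first exact: measurableU.
  move=> w; apply: contraPP => /not_orP[/noiseP noise gooD] /=; apply/negP;
    rewrite -leNgt.
  have [low up] := gram_bounds designX CmaxL n_gt0 (m_gt1 sp) gooD (rm sp).
  have aU : a <= U.
    have K21 : 1 <= K ^+ 2 by exact: exprn_ege1.
    apply: (@le_trans _ _ L); first by rewrite /a; have := Cmin_gt0; have := CminL; lra.
    by rewrite /U ler_peMl ?(ltW L_gt0)//; lra.
  have [_ small] := sparse sp.
  have small' : r * s * (144 * U / a + 1) <= a / 144.
    by apply: le_trans small; rewrite le_eqVlt /r; apply/orP; left; apply/eqP; ring.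
  have lj : 8 * r * U ^+ 2 <= a * lambdaj ^+ 2.
    have -> : 8 * r * U ^+ 2 = 8 * Cr * U ^+ 2 * delta by rewrite /r; ring.
    rewrite [lambdaj ^+ 2]exprMn sqdE [leRHS]mulrA.
    by apply: ler_wpM2r => //; exact: ltW.
  apply: le_trans (BSDB_remainder_le n_gt0 lambda_gt0 lambdaj_gt0 erefl noise (bhatP w)
    (bstarP w) (kappaP w) erefl a_gt0 aU r_ge0 s1 low up small' lj) _.
  have -> : 180 / a ^+ 2 * lambda * lambdaj * s =
    180 / a ^+ 2 * c1 * c2 * (s * (Num.sqrt delta ^+ 2)).
    by rewrite /lambda /lambdaj; ring.
  by rewrite sqdE /delta mulrA.
apply: le_trans (measureU2 _ _ _) _ => //.
by rewrite EFinD; apply: leeD; [exact: noise_event_le|exact: design_event_le].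
Qed.

End tail.

(** * Asymptotics *)

Lemma limn_esup_le_near (R : realType) (u : nat -> \bar R) (l : \bar R) :
  (\forall n \near \oo, (u n <= l)%E) -> (limn_esup u <= l)%E.
Proof.
move=> ul; rewrite /limn_esup /limf_esup.
apply: (@le_trans _ _ (ereal_sup (u @` [set n | (u n <= l)%E]))).
  by apply: ereal_inf_lbound; exists [set n | (u n <= l)%E].
by apply: ge_ereal_sup => _ [n /= un <-].
Qed.

Lemma expRN_le_inv (R : realType) (x : R) : 0 < x -> expR (- x) <= x^-1.
Proof.
move=> x0; rewrite expRN lef_pV2 ?posrE ?expR_gt0//.
by apply: le_trans (expR_ge1Dx x); rewrite lerDr.
Qed.

Theorem theorem3p7 (R : realType) (Cmin Cmax K1 K2 sigma : R)
    (Cmin_gt0 : 0 < Cmin) (sigma_gt0 : 0 < sigma) :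
  exists c1_0 c2_0 : R, forall c1 c2 : R, c1_0 <= c1 -> c2_0 <= c2 ->
  forall (d : nat -> measure_display) (T : forall n, measurableType (d n))
    (P : forall n, probability (T n) R)
    (p : nat -> nat)
    (beta : forall n, 'cV[R]_(p n))
    (Sigma : forall n, 'M[R]_(p n))
    (j : forall n, 'I_(p n))
    (Xrv : forall n, {RV (P n) >-> n.-tuple ((p n).-tuple R)})
    (epsrv : forall n, {RV (P n) >-> n.-tuple R})
    (bhatrv kapparv bstarrv : forall n, {RV (P n) >-> (p n).-tuple R}),
  let s n := #|supp (beta n)| in
  let X n w := mx_of_rows (Xrv n w) in
  let eps n w := col_of_tuple (epsrv n w) in
  let y n w := X n w *m beta n + eps n w in
  let lambda n := c1 * Num.sqrt (ln (p n)%:R / n%:R) in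
  let lambdaj n := c2 * Num.sqrt (ln (p n)%:R / n%:R) in
  let bhat n w := col_of_tuple (bhatrv n w) in
  let kappa n w := col_of_tuple (kapparv n w) in
  let bstar n w := col_of_tuple (bstarrv n w) in
  let what n w := score (X n w) (j n) (kappa n w) in
  p n @[n --> \oo] --> \oo ->
  (fun n => (s n)%:R * ln (p n)%:R : R^o) =o_\oo (fun n => n%:R : R^o) ->
  (forall n, indep2 (P n) (Xrv n) (epsrv n)) ->
  (forall n, subgaussian_errors (epsrv n) sigma K2) ->
  (forall n, subgaussian_design (Xrv n) (Sigma n) Cmin Cmax K1) ->
  (forall n w, is_lasso (X n w) (y n w) (lambda n) (bhat n w)) ->
  (forall n w,
    is_kappa (X n w) (supp (bhat n w)) (j n) (lambdaj n) (kappa n w)) ->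
  (forall n w,
    is_lasso (X n w) (X n w *m bhat n w) (lambda n) (bstar n w)) ->
  O_in_prob P
    (fun n w => BSDB (X n w) (y n w) (j n) (bhat n w) (bstar n w) (what n w)
                - beta n (j n) 0 - dotv (what n w) (eps n w) / n%:R)
    (fun n => (s n)%:R * ln (p n)%:R / n%:R).
Proof.
(* The thresholds for [c1] and [c2] are fixed before any design is given; the maxima make the
   constants positive and [L] at least [Cmin]. *)
pose K := Num.max K1 1; pose Ke := Num.max K2 1; pose L := Num.max Cmax Cmin.
have K_ge1 : 1 <= K by rewrite le_max lexx orbT.
have K1K : K1 <= K by rewrite le_max lexx.
have Ke_gt0 : 0 < Ke by rewrite lt_max ltr01 orbT.
have K2Ke : K2 <= Ke by rewrite le_max lexx.
have CmaxL : Cmax <= L by rewrite le_max lexx.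
have CminL : Cmin <= L by rewrite le_max lexx orbT.
pose a := Cmin / 2; pose U := 32 * K ^+ 2 * L; pose c0 := (256 * K ^+ 4)^-1.
pose Cr := U * (8 / c0).
have K_gt0 : 0 < K by exact: lt_le_trans K_ge1.
have L_gt0 : 0 < L by exact: lt_le_trans CminL.
have a_gt0 : 0 < a by exact: divr_gt0.
have U_gt0 : 0 < U by rewrite !mulr_gt0// exprn_gt0.
have c0_gt0 : 0 < c0 by rewrite invr_gt0 mulr_gt0// exprn_gt0.
have Cr_gt0 : 0 < Cr by rewrite mulr_gt0// divr_gt0.
pose B1 := 192 ^+ 2 * (K ^+ 2 * L) * Ke ^+ 2; pose B2 := 8 * Cr * U ^+ 2 / a.
have B1_ge0 : 0 <= B1 by rewrite !mulr_ge0 ?sqr_ge0// ltW.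
have B2_ge0 : 0 <= B2.
  apply: divr_ge0; last exact: ltW.
  by apply: mulr_ge0 (sqr_ge0 _); apply: mulr_ge0 => //; exact: ltW.
(* What is wanted is [c > 0] and [c^2 >= B]; [c >= B + 1] with [B >= 0] gives both without a square
   root. *)
exists (B1 + 1), (B2 + 1) => c1 c2 hc1 hc2 d T P p beta Sigma j Xrv epsrv bhatrv
  kapparv bstarrv.
move=> s X eps y lambda lambdaj bhat kappa bstar what p_oo s_small indep errors
  design lassoP kappaP bootP.
have sqr_large (B c : R) : 0 <= B -> B + 1 <= c -> 0 < c /\ B <= c ^+ 2.
  by move=> B0 Bc; split; [lra|nra].
have [c1_gt0 c1_large] := sqr_large _ _ B1_ge0 hc1.
have [c2_gt0 B2c2] := sqr_large _ _ B2_ge0 hc2.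
have c2_large : 8 * Cr * U ^+ 2 <= a * c2 ^+ 2 by rewrite [leRHS]mulrC -ler_pdivrMr.
(* One [M] serves every [delta], because the failure probability tends to 0. *)
move=> delta delta_gt0; exists (180 / a ^+ 2 * c1 * c2).
apply: limn_esup_le_near.
(* A level for [s log p / n] that meets both requirements of [sparse]; the first concerns
   [log p / n] alone and follows because [s >= 1] there. *)
pose eta := Num.min (c0 / 16) (a / 144 / (Cr * (144 * U / a + 1))).
have f_gt0 : 0 < 144 * U / a + 1 by rewrite addr_gt0// divr_gt0// mulr_gt0.
have eta_gt0 : 0 < eta.
  by rewrite lt_min; apply/andP; split; rewrite divr_gt0// ?divr_gt0// mulr_gt0.
have [eta1 eta2] : eta <= c0 / 16 /\ Cr * eta * (144 * U / a + 1) <= a / 144.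
  split; first by rewrite ge_min lexx.
  have Crf : 0 < Cr * (144 * U / a + 1) by exact: mulr_gt0.
  by rewrite mulrAC [leLHS]mulrC -ler_pdivlMr// ge_min lexx orbT.
have near_s : \forall n \near \oo, (s n)%:R * ln (p n)%:R <= eta * n%:R :> R.
  have /eqoP/(_ _ eta_gt0) := s_small.
  apply: filterS => n; rewrite /= (ger0_norm (ler0n _ n)).
  by apply: le_trans; exact: ler_norm.
have near_p (b : R) : \forall n \near \oo, b <= (p n)%:R.
  exact: (p_oo _ (nbhs_infty_ger b)).
near=> n.
have n_gt0 : (0 < n)%N by near: n; exact: nbhs_infty_gt.
have p_gt1 : (1 < p n)%N.
  by rewrite -(ler_nat R); near: n; exact: near_p.
have nR : 0 < n%:R :> R by rewrite ltr0n.
have pR : 0 < (p n)%:R :> R by rewrite ltr0n ltnW.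
have sparse : 0 < (s n)%:R :> R ->
    ln (p n)%:R / n%:R <= c0 / 16 /\
    Cr * ((s n)%:R * (ln (p n)%:R / n%:R)) * (144 * U / a + 1) <= a / 144.
  rewrite ltr0n => sn.
  have lnp : 0 <= ln (p n)%:R :> R by rewrite ln_ge0// ler1n ltnW.
  have sd : (s n)%:R * (ln (p n)%:R / n%:R) <= eta.
    by rewrite mulrA ler_pdivrMr//; near: n; exact: near_s.
  split; last by apply: le_trans eta2; rewrite ler_pM2r// ler_pM2l.
  apply: le_trans eta1; apply: le_trans sd; rewrite ler_peMl ?ler1n//.
  by rewrite divr_ge0// ltW.
apply: le_trans (BSDB_tail (design n) (errors n) (indep n) (lassoP n) (kappaP n)
  (bootP n)
  K_ge1 K1K Ke_gt0 K2Ke Cmin_gt0 CminL CmaxL n_gt0 p_gt1 c1_gt0 c1_large c2_gt0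
    c2_large sparse) _.
rewrite lee_fin.
have t1 : expR (- n%:R) <= delta / 3.
  apply: le_trans (expRN_le_inv nR) _;
    rewrite -[leRHS]invrK lef_pV2 ?posrE ?invr_gt0 ?divr_gt0//.
  by near: n; exact: nbhs_infty_ger.
have t2 : 2 / (p n)%:R <= delta / 3.
  rewrite ler_pdivrMr// -ler_pdivrMl ?divr_gt0//; near: n; exact: near_p.
have t3 : 2 * expR (- (c0 * n%:R / 2)) <= delta / 3.
  have cn : 0 < c0 * n%:R / 2 by rewrite divr_gt0// mulr_gt0.
  apply: (@le_trans _ _ (2 * (c0 * n%:R / 2)^-1)).
    by rewrite ler_pM2l//; exact: expRN_le_inv.
  rewrite ler_pdivrMr// -ler_pdivrMl ?divr_gt0// ler_pdivlMr// -ler_pdivrMl//.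
  by near: n; exact: nbhs_infty_ger.
lra.
Unshelve. all: by end_near.
Qed.
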